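(* Let $f:\mathbb D\to\mathbb D$ be analytic, let $\alpha\in\partial\mathbb D$, let $\sigma=\sigma_\alpha$ be the Aleksandrov–Clark measure of $f$ at $\alpha$, and let $$u(z)=\int_{\partial\mathbb D}\frac{1-|z|^2}{|\xi-z|^2}\,d\sigma(\xi),\qquad z\in\mathbb D.$$ The following are equivalent: (a) $f$ is contractive. (b) There is a constant $c>0$ such that $\dfrac{\sigma(I)}{|I|}\ge c\,u(z_I)$ for every arc $I\subset\partial\mathbb D$. (c) $u$ is a Bekollé–Bonami $B_2$ weight, i.e. $$[u]_{B_2}:=\sup_Q\Big(\frac1{A(Q)}\int_Q u\,dA\Big)\Big(\frac1{A(Q)}\int_Q\frac{dA}{u}\Big)<\infty,$$ the supremum being over all Carleson boxes $Q\subset\mathbb D$.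
   Context: $\mathbb D$ is the open unit disc, $m$ is normalized Lebesgue (arc-length) measure on $\partial\mathbb D$ ($m(\partial\mathbb D)=1$), and for an arc $I\subset\partial\mathbb D$ we write $|I|=m(I)$. $dA$ is normalized area measure on $\mathbb D$. For an arc $I$ with center $\xi_I$, $z_I=(1-|I|)\xi_I$. The Carleson box of $I$ is $Q(I)=\{z\in\mathbb D: 1-|z|\le |I|,\ z/|z|\in I\}$. For analytic $f:\mathbb D\to\mathbb D$, the hyperbolic derivative is $D_h(f)(z)=\frac{(1-|z|^2)|f'(z)|}{1-|f(z)|^2}$, and $f$ is called contractive if $\sup_{z\in\mathbb D}D_h(f)(z)<1$. For $\alpha\in\partial\mathbb D$, the Aleksandrov–Clark measure $\sigma_\alpha$ of $f$ is the unique positive finite Borel measure on $\partial\mathbb D$ such that $\frac{1-|f(z)|^2}{|\alpha-f(z)|^2}=\int_{\partial\mathbb D}\frac{1-|z|^2}{|\xi-z|^2}\,d\sigma_\alpha(\xi)$ for all $z\in\mathbb D$. *)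

(* Defs.v *)
From mathcomp Require Import all_boot all_order all_algebra.
From mathcomp Require Import all_classical all_reals all_analysis.
From mathcomp Require Export complex.
Import numFieldNormedType.Exports.
Import Order.TTheory GRing.Theory Num.Theory.

Set Implicit Arguments.
Unset Strict Implicit.
Unset Printing Implicit Defensive.

Local Open Scope classical_set_scope.
Local Open Scope ring_scope.

Section Defs.
Variable R : realType.

Definition cmod (z : R[i]) : R := Num.sqrt (complex.Re z ^+ 2 + complex.Im z ^+ 2).

(* the point e^{2 pi i t} of the unit circle; the circle is parametrized by
   t in [0,1), under which normalized arc length m becomes Lebesgue measure *)
Definition circ (t : R) : R[i] := (cos (2 * pi * t) +i* sin (2 * pi * t))%C.

Definition analytic_self_map (f : R[i] -> R[i]) : Prop :=
  forall z : R[i], cmod z < 1 ->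
    cmod (f z) < 1 /\ derivable (f : R[i]^o -> R[i]^o) z 1.

Definition hyp_deriv (f : R[i] -> R[i]) (z : R[i]) : R :=
  (1 - cmod z ^+ 2) * cmod ('D_1 (f : R[i]^o -> R[i]^o) z) / (1 - cmod (f z) ^+ 2).

Definition contractive (f : R[i] -> R[i]) : Prop :=
  exists k : R, k < 1 /\ forall z : R[i], cmod z < 1 -> hyp_deriv f z <= k.

Definition poisson (z : R[i]) (t : R) : R :=
  (1 - cmod z ^+ 2) / cmod (circ t - z) ^+ 2.

(* sigma is the Aleksandrov-Clark measure of f at alpha: a positive finite Borel
   measure on the circle (here: on [0,1), via t |-> e^{2 pi i t}) with
   (1-|f z|^2)/|alpha - f z|^2 = int P(z,xi) dsigma(xi) on D. *)
Definition clark_measure (f : R[i] -> R[i]) (alpha : R[i])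
    (sigma : {measure set R -> \bar R}) : Prop :=
  sigma (~` `[0%R, 1%R[) = 0%E /\ (sigma setT < +oo)%E /\
  forall z : R[i], cmod z < 1 ->
    (((1 - cmod (f z) ^+ 2) / cmod (alpha - f z) ^+ 2)%:E =
      \int[sigma]_(t in `[0%R, 1%R[) (poisson z t)%:E)%E.

(* u(z) = int P(z,xi) dsigma(xi)  (finite on D, so we take its real value) *)
Definition poisson_int (sigma : {measure set R -> \bar R}) (z : R[i]) : R :=
  fine (\int[sigma]_(t in `[0%R, 1%R[) (poisson z t)%:E)%E.

(* the closed arc {e^{2 pi i s} : a <= s <= a + l}, as a subset of the
   parameter interval [0,1); its normalized length is l (0 < l <= 1) *)
Definition circ_arc (a l : R) : set R :=
  [set t | 0 <= t < 1 /\ exists k : int, a <= t + k%:~R <= a + l].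

Definition z_arc (a l : R) : R[i] := ((1 - l)%:C * circ (a + l / 2))%C.

Definition carleson_box (a l : R) : set (R * R) :=
  [set p | let z := (p.1 +i* p.2)%C in
     0 < cmod z < 1 /\ 1 - cmod z <= l /\
     exists t, circ_arc a l t /\ (z / (cmod z)%:C)%C = circ t].

Definition areaA : set (R * R) -> \bar R :=
  fun A => ((pi^-1)%:E * (@lebesgue_measure R \x @lebesgue_measure R) A)%E.

Definition box_avg (g : R[i] -> R) (Q : set (R * R)) : \bar R :=
  ((areaA Q)^-1 *
   ((pi^-1)%:E * \int[@lebesgue_measure R \x @lebesgue_measure R]_(p in Q)
                   (g (p.1 +i* p.2)%C)%:E))%E.

Definition B2_weight (u : R[i] -> R) : Prop :=
  exists C : R, forall a l : R, 0 < l <= 1 ->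
    (box_avg u (carleson_box a l) * box_avg (fun z => ((u z)^-1)%R) (carleson_box a l)
      <= C%:E)%E.

End Defs.

(* Main.v *)
Require Import Defs.
From mathcomp Require Import all_boot all_order all_algebra.
From mathcomp Require Import all_classical all_reals all_analysis.
From mathcomp Require Import complex measurable_realfun.
From mathcomp Require Import ring lra.
Import numFieldNormedType.Exports.
Import Order.TTheory GRing.Theory Num.Theory.
Set Implicit Arguments.
Unset Strict Implicit.
Unset Printing Implicit Defensive.
Local Open Scope classical_set_scope.
Local Open Scope ring_scope.

(** Write e for a point of the circle, P_z for the Poisson kernel and
    w = (1 - conj z e) / (e - z), a unimodular number. Since u is the real part
    of (alpha + f) / (alpha - f), differentiating the Poisson integral gives
    D_h(f)(z) u(z) = |int w P_z dsigma|; so f is contractive iff the barycentre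
    of w under P_z dsigma / u(z) stays in a disc of radius k < 1, uniformly in z.

    (a) => (b). Along a radius, P_{z'} / P_z is an explicit convex function of
    the real part of a rotation of w. Its tangent and its chord show that when
    (1 + |z|) / (1 - |z|) doubles, u changes by a factor between 1/L and L, with
    L = (5 + 3k) / 4 < 2. Hence at height h over the centre of I,
    u >= (h/|I|)^{log_2 L} u(z_I) up to constants, whereas the part of sigma off
    I contributes only O(h/|I|) u(z_I); for h a small multiple of |I| the arc I
    must carry the rest.

    (b) => (a). Two small arcs near z/|z| carry a fixed fraction of u(z), and the
    corresponding values of w are separated, so the barycentre is not close to
    the circle.

    (a) => (c). By the same growth estimate u and 1/u are at most
    L^m u(z_I)^{+-1} on the part of Q(I) at height 2^{-m}|I|, which is covered by
    O(2^m) squares of side O(2^{-m}|I|), and L < 2.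

    (c) => (b). If sigma(I) <= 4^{-N} |I| u(z_I), then on each of the levels
    y = 4^{-n-1} |I|, n < N, the sum of u over y-spaced points is O(u(z_I)), so by
    the Cauchy-Schwarz inequality the level contributes at least a constant
    times |I|^2 / u(z_I) to the integral of 1/u over Q(I); this bounds N. *)

(** * The modulus and the circle *)

Section Modulus.
Variable R : realType.
Implicit Types (z w : R[i]) (x y t s : R).

Lemma cmodE z : cmod z = ComplexField.Normc.normc z.
Proof. by case: z. Qed.

Lemma normcE_cmod z : `|z| = (cmod z)%:C%C.
Proof. by rewrite normc_def. Qed.

Lemma sqr_cmod z : cmod z ^+ 2 = complex.Re z ^+ 2 + complex.Im z ^+ 2.
Proof. by rewrite sqr_sqrtr // addr_ge0 // sqr_ge0. Qed.

Lemma cmod_ge0 z : 0 <= cmod z.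
Proof. exact: sqrtr_ge0. Qed.

Lemma cmodM z w : cmod (z * w) = cmod z * cmod w.
Proof. by rewrite !cmodE ComplexField.Normc.normcM. Qed.

Lemma cmodV z : cmod z^-1 = (cmod z)^-1.
Proof. by rewrite !cmodE ComplexField.Normc.normcV. Qed.

Lemma cmodN z : cmod (- z) = cmod z.
Proof. by rewrite !cmodE normcN. Qed.

Lemma cmodB z w : cmod (z - w) = cmod (w - z).
Proof. by rewrite -cmodN opprB. Qed.

Lemma cmodD z w : cmod (z + w) <= cmod z + cmod w.
Proof. by rewrite !cmodE le_normcD. Qed.

Lemma cmodR x : cmod x%:C%C = `|x|.
Proof. by rewrite /cmod /= expr0n addr0 sqrtr_sqr. Qed.

Lemma cmod0 : cmod (0 : R[i]) = 0.
Proof. by rewrite -[0]/(0%:C%C) cmodR normr0. Qed.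

Lemma cmod1 : cmod (1 : R[i]) = 1.
Proof. by rewrite -[1]/(1%:C%C) cmodR normr1. Qed.

Lemma cmod_eq0 z : (cmod z == 0) = (z == 0).
Proof.
apply/eqP/eqP => [|->]; last exact: cmod0.
by rewrite cmodE => /ComplexField.Normc.eq0_normc.
Qed.

Lemma cmod_gt0 z : (0 < cmod z) = (z != 0).
Proof. by rewrite lt_neqAle cmod_ge0 andbT eq_sym cmod_eq0. Qed.

Lemma cmodJ z : cmod z^*%C = cmod z.
Proof. by case: z => a b; rewrite /cmod /= sqrrN. Qed.

Lemma cmodBD z w v : cmod (z - w) <= cmod (z - v) + cmod (v - w).
Proof. by rewrite (_ : z - w = (z - v) + (v - w)) ?cmodD //; ring. Qed.

Lemma cmod_subl z w : cmod z - cmod w <= cmod (z - w).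
Proof. by rewrite lerBlDr -{1}(subrK w z) cmodD. Qed.

Lemma Re_le_cmod z : complex.Re z <= cmod z.
Proof.
apply: le_trans (ler_norm _) _; rewrite -sqrtr_sqr ler_wsqrtr // lerDl.
exact: sqr_ge0.
Qed.

Lemma normRe_le_cmod z : `|complex.Re z| <= cmod z.
Proof. by rewrite -sqrtr_sqr ler_wsqrtr // lerDl sqr_ge0. Qed.

Lemma normIm_le_cmod z : `|complex.Im z| <= cmod z.
Proof. by rewrite -sqrtr_sqr ler_wsqrtr // lerDr sqr_ge0. Qed.

Lemma cmod_le_ReIm z : cmod z <= `|complex.Re z| + `|complex.Im z|.
Proof.
rewrite -(ler_pXn2r (n := 2)) ?nnegrE ?cmod_ge0 ?addr_ge0 //.
rewrite sqr_cmod sqrrD !real_normK ?num_real // lerD2r lerDl mulrn_wge0 //.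
Qed.

Lemma ReB z w : complex.Re (z - w) = complex.Re z - complex.Re w.
Proof. by case: z; case: w. Qed.

Lemma ReZ x z : complex.Re (x%:C%C * z) = x * complex.Re z.
Proof. by case: z => a b /=; rewrite mul0r subr0. Qed.

Lemma conjcB z w : (z - w)^*%C = z^*%C - w^*%C.
Proof. exact: rmorphB. Qed.

Lemma conjcD z w : (z + w)^*%C = z^*%C + w^*%C.
Proof. exact: rmorphD. Qed.

Lemma conjcM z w : (z * w)^*%C = z^*%C * w^*%C.
Proof. exact: rmorphM. Qed.

Lemma mulcJ z : z * z^*%C = (cmod z ^+ 2)%:C%C.
Proof.
rewrite sqr_cmod; case: z => a b /=; apply/eqP; rewrite eq_complex /=.
by apply/andP; split; apply/eqP; ring.
Qed.

Lemma exists_unimodular z : exists v, cmod v = 1 /\ complex.Re (v * z) = cmod z.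
Proof.
have [->|z0] := eqVneq z 0; first by exists 1; rewrite cmod1 mulr0 cmod0.
have c0 : cmod z != 0 by rewrite cmod_eq0.
exists ((cmod z)^-1%:C%C * z^*%C); split.
  by rewrite cmodM cmodJ cmodR ger0_norm ?invr_ge0 ?cmod_ge0 // mulVf.
by rewrite -mulrA ReZ (mulrC _ z) mulcJ /= expr2 mulKf.
Qed.

Lemma cmod_circ t : cmod (circ t) = 1.
Proof. by rewrite /cmod /= cos2Dsin2 sqrtr1. Qed.

Lemma circD_int t (k : int) : circ (t + k%:~R) = circ t.
Proof.
have circ1 s : circ (s + 1) = circ s.
  have e : 2 * pi * (s + 1) = 2 * pi * s + pi *+ 2 by rewrite mulr2n; ring.
  by rewrite /circ e cosD2pi sinD2pi.
have circn s (n : nat) : circ (s + n%:R) = circ s.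
  by elim: n s => [|n IH] s; rewrite ?addr0 // -natr1 addrA circ1.
case: k => n; first by rewrite -pmulrn circn.
rewrite NegzE mulrNz -pmulrn -(circn (t - n.+1%:R) n.+1) subrK.
by [].
Qed.

Lemma pi_lt4 : pi < 4 :> R.
Proof. have := pihalf_lt2 R; lra. Qed.

Lemma sqr_chord s t : cmod (circ s - circ t) ^+ 2 = 4 * sin (pi * (s - t)) ^+ 2.
Proof.
rewrite sqr_cmod /circ /=.
have : cos (2 * pi * s - 2 * pi * t) = 1 - 2 * sin (pi * (s - t)) ^+ 2.
  rewrite (_ : _ - _ = pi * (s - t) *+ 2); last by rewrite mulr2n; ring.
  by rewrite cos_mulr2n cos2sin2 mulr2n; ring.
rewrite cosB.
have := cos2Dsin2 (2 * pi * s); have := cos2Dsin2 (2 * pi * t).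
move: (cos (2 * pi * s)) (sin (2 * pi * s)) (cos (2 * pi * t)) (sin (2 * pi * t)).
move=> c1 s1 c2 s2 h1 h2 h3; lra.
Qed.

Lemma chord s t : cmod (circ s - circ t) = 2 * `|sin (pi * (s - t))|.
Proof.
apply/eqP; rewrite -(eqrXn2 (n := 2)) ?cmod_ge0 ?mulr_ge0 //.
rewrite sqr_chord exprMn real_normK ?num_real //; apply/eqP; ring.
Qed.

Lemma sin_MVT x : 0 <= x -> exists2 c, 0 <= c <= x & sin x = cos c * x.
Proof.
move=> x0.
have dsin y : y \in `]0, x[ -> is_derive y 1 (@sin R) (cos y).
  by move=> _; exact: is_derive_sin.
have csin : {within `[0, x], continuous (@sin R)}.
  by apply: continuous_subspaceT => y; exact: continuous_sin.
have [c] := MVT_segment x0 dsin csin.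
by rewrite in_itv /= => cx; rewrite sin0 !subr0 => h; exists c.
Qed.

Lemma sin_le_id x : 0 <= x -> sin x <= x.
Proof.
move=> x0; have [c _ ->] := sin_MVT x0.
by rewrite -[leRHS]mul1r ler_wpM2r // cos_le1.
Qed.

Lemma normr_sin_le x : `|sin x| <= `|x|.
Proof.
wlog x0 : x / 0 <= x.
  by move=> h; have [/h//|/ltW x0] := leP 0 x; rewrite -normrN -sinN -(normrN x) h ?oppr_ge0.
rewrite (ger0_norm x0) ler_norml sin_le_id // andbT.
have [x1|x1] := leP x pi.
  by apply: le_trans (sin_ge0_pi _); rewrite ?oppr_le0 ?x0.
by apply: le_trans (sin_geN1 _); have := pi_ge2 R; lra.
Qed.

Lemma chord_le s t : cmod (circ s - circ t) <= 8 * `|s - t|.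
Proof.
rewrite chord; have := normr_sin_le (pi * (s - t)).
rewrite normrM (ger0_norm (pi_ge0 R)).
have := pi_lt4; have := normr_ge0 (s - t).
set d := `|s - t| => *; nra.
Qed.

Lemma cos_ge0_pos x : 0 <= x -> x <= pi / 2 -> 0 <= cos x.
Proof. by move=> x0 x1; apply: cos_ge0_pihalf; rewrite x1 andbT; have := pi_ge0 R; lra. Qed.

(* sin 2v = 2 sin v cos v >= 2 v (cos v)^2, and (cos v)^2 >= 1/2 for v <= pi/4 *)
Lemma sin_ge_half x : 0 <= x <= pi / 2 -> x / 2 <= sin x.
Proof.
move=> /andP[x0 x1]; set v := x / 2.
have v0 : 0 <= v by rewrite /v; lra.
have vp : v <= pi / 4 by rewrite /v; lra.
have pip := pi_gt0 R.
have -> : x = v *+ 2 by rewrite mulr2n /v; lra.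
rewrite sin_mulr2n mulr2n.
have [c /andP[c0 cv] ->] := sin_MVT v0.
have cvc : cos v <= cos c.
  have [->//|nvc] := eqVneq c v.
  by apply/ltW; rewrite ltr_cos ?in_itv /= ?c0 ?v0 ?lt_neqAle ?nvc //=; lra.
have cv0 : 0 <= cos v by apply: cos_ge0_pos => //; lra.
have cv2 : 1 <= 2 * cos v ^+ 2.
  have : 0 <= cos (v *+ 2).
    by apply: cos_ge0_pos; rewrite mulr2n; lra.
  by rewrite cos_mulr2n mulr2n; lra.
rewrite mulrA.
have : cos v ^+ 2 <= cos v * cos c by rewrite expr2 ler_wpM2l.
move: (cos v * cos c) => q; nra.
Qed.

Lemma normr_sinpi_ge x : `|x| <= 1 / 2 -> `|x| <= `|sin (pi * x)|.
Proof.
wlog x0 : x / 0 <= x.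
  move=> h; have [/h//|/ltW x0] := leP 0 x.
  by rewrite -normrN -(normrN (sin _)) -sinN -mulrN; apply: h; rewrite oppr_ge0.
rewrite (ger0_norm x0) => x1; apply: le_trans (ler_norm _).
have p2 := pi_ge2 R.
by apply: le_trans (sin_ge_half _); nra.
Qed.

Lemma chord_ge s t : `|s - t| <= 1 / 2 -> 2 * `|s - t| <= cmod (circ s - circ t).
Proof. by move=> h; rewrite chord ler_pM2l // normr_sinpi_ge. Qed.

(** If the difference exceeds 1/2, the other way round the circle has length between 1/4 and 1/2;
    shifting one parameter by a full turn reduces to [chord_ge]. The range 3/4 = 1/2 + 1/4 arises
    when a point within 1/2 of the centre of an arc is compared with one in its middle half. *)
Lemma chord_ge34 s t : `|s - t| <= 3 / 4 -> `|s - t| / 2 <= cmod (circ s - circ t).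
Proof.
move=> h; have [/chord_ge|h2] := leP `|s - t| (1 / 2).
  by apply: le_trans; have := normr_ge0 (s - t); lra.
wlog st : s t h h2 / t <= s.
  move=> H; have [/(H _ _ h h2)//|/ltW] := leP t s.
  by rewrite cmodB distrC; apply: H; rewrite distrC.
have e : `|s - t| = s - t by rewrite ger0_norm // subr_ge0.
rewrite e in h h2 *.
have e2 : `|s - 1 - t| = 1 - (s - t) by rewrite ler0_norm; lra.
have := @chord_ge (s - 1) t; rewrite e2 -[s - 1]/(s + (-1)%:~R) circD_int.
move=> /(_ _); lra.
Qed.

Lemma near_int t c : exists k : int, `|t + k%:~R - c| <= 1 / 2.
Proof.
exists (- Num.floor (t - c + 1 / 2)).
have /andP[] := floor_itv (t - c + 1 / 2).
rewrite intrD mulrNz; set n := _%:~R => h1 h2.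
by rewrite ler_norml; lra.
Qed.

Lemma polar z : exists t, z = (cmod z)%:C%C * circ t.
Proof.
have [->|z0] := eqVneq z 0; first by exists 0; rewrite cmod0 mul0r.
have c0 : 0 < cmod z by rewrite cmod_gt0.
pose x := complex.Re z / cmod z; pose y := complex.Im z / cmod z.
have xy : x ^+ 2 + y ^+ 2 = 1.
  by rewrite /x /y !exprMn exprVn -mulrDl -sqr_cmod divff // lt0r_neq0 // exprn_gt0.
have x1 : -1 <= x <= 1 by have := sqr_ge0 y; nra.
have zE : z = (cmod z)%:C%C * (x +i* y)%C.
  rewrite /x /y; case: z z0 c0 {x y xy x1} => a b z0 c0.
  apply/eqP; rewrite eq_complex /= !mul0r subr0 addr0.
  by apply/andP; split; apply/eqP; field; exact: lt0r_neq0.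
have p0 := pi_gt0 R.
have sx : sin (acos x) = `|y|.
  rewrite sin_acos // (_ : 1 - x ^+ 2 = y ^+ 2) ?sqrtr_sqr //; lra.
have cx : cos (acos x) = x by rewrite acosK // in_itv.
have pE (u : R) : 2 * pi * (u / (2 * pi)) = u.
  by rewrite mulrC divfK // lt0r_neq0 // mulr_gt0.
have [y0|y0] := leP 0 y.
  exists (acos x / (2 * pi)); rewrite {1}zE; congr (_ * _).
  by rewrite /circ pE cx sx ger0_norm.
exists (- acos x / (2 * pi)); rewrite {1}zE; congr (_ * _).
by rewrite /circ pE cosN sinN cx sx ltr0_norm // opprK.
Qed.

Lemma polar_near z c : exists d, `|d| <= 1 / 2 /\ z = (cmod z)%:C%C * circ (c + d).
Proof.
have [t zt] := polar z; have [k tk] := near_int t c.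
by exists (t + k%:~R - c); split=> //; rewrite addrC subrK circD_int.
Qed.

End Modulus.

(** * The Poisson kernel *)

Section PoissonKernel.
Variable R : realType.
Implicit Types (z w v h : R[i]) (a r s t p A B : R).

Lemma cmod_circB_ge z t : 1 - cmod z <= cmod (circ t - z).
Proof. by have := cmod_subl (circ t) z; rewrite cmod_circ. Qed.

Lemma cmod_circB_gt0 z t : cmod z < 1 -> 0 < cmod (circ t - z).
Proof. by move=> z1; apply: lt_le_trans (cmod_circB_ge z t); rewrite subr_gt0. Qed.

Lemma circB_neq0 z t : cmod z < 1 -> circ t - z != 0.
Proof. by move=> z1; rewrite -cmod_gt0 cmod_circB_gt0. Qed.

Lemma onemsqr_cmod_bounds z : cmod z < 1 ->
  1 - cmod z <= 1 - cmod z ^+ 2 <= 2 * (1 - cmod z).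
Proof. by move=> z1; have := cmod_ge0 z; move: (cmod z) z1 => x x1 x0; nra. Qed.

Lemma onemsqr_cmod_gt0 z : cmod z < 1 -> 0 < 1 - cmod z ^+ 2.
Proof. by move=> z1; have := onemsqr_cmod_bounds z1; lra. Qed.

Lemma poisson_gt0 z t : cmod z < 1 -> 0 < poisson z t.
Proof.
by move=> z1; rewrite divr_gt0 ?exprn_gt0 ?cmod_circB_gt0 ?onemsqr_cmod_gt0.
Qed.

Lemma poisson_le z t : cmod z < 1 -> poisson z t <= 2 / (1 - cmod z).
Proof.
move=> z1; have := cmod_circB_ge z t; have := onemsqr_cmod_bounds z1.
rewrite /poisson ler_pdivrMr ?exprn_gt0 ?cmod_circB_gt0 //.
rewrite mulrAC ler_pdivlMr ?subr_gt0 //.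
move: (1 - cmod z ^+ 2) (cmod (_ - _)) => q c h1 h2.
have : 1 - cmod z > 0 by rewrite subr_gt0.
move: (1 - cmod z) h1 h2 => x /andP[_ h1] h2 x0.
have : x * x <= c * c by apply: ler_pM => //; exact: ltW.
have : q * x <= 2 * x * x by rewrite ler_pM2r.
lra.
Qed.

Lemma poisson_ge z t A : cmod z < 1 -> cmod (circ t - z) <= A ->
  (1 - cmod z) / A ^+ 2 <= poisson z t.
Proof.
move=> z1 zA; have z0 := cmod_circB_gt0 t z1.
have /andP[h1 _] := onemsqr_cmod_bounds z1.
apply: ler_pM => //; first by rewrite subr_ge0 ltW.
  by rewrite invr_ge0 exprn_ge0 // (le_trans _ zA) // ltW.
rewrite lef_pV2 ?posrE ?exprn_gt0 ?(lt_le_trans z0 zA) //.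
by rewrite lerXn2r ?nnegrE ?(ltW z0) // (le_trans (ltW z0)).
Qed.

(** Comparing distances to e costs [A ^+ 2]. Comparing heights costs [2 * B], since 1 - |z|^2 lies
    between 1 - |z| and twice that. *)
Lemma poisson_comp z w t A B : cmod z < 1 -> cmod w < 1 -> 0 <= B ->
  cmod (circ t - w) <= A * cmod (circ t - z) -> 1 - cmod z <= B * (1 - cmod w) ->
  poisson z t <= 2 * B * A ^+ 2 * poisson w t.
Proof.
move=> z1 w1 B0 hA hB.
have z0 := cmod_circB_gt0 t z1; have w0 := cmod_circB_gt0 t w1.
have /andP[_ hz] := onemsqr_cmod_bounds z1.
have /andP[hw _] := onemsqr_cmod_bounds w1.
have zw : 1 - cmod z ^+ 2 <= 2 * B * (1 - cmod w ^+ 2) by nra.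
have A2 : cmod (circ t - w) ^+ 2 <= A ^+ 2 * cmod (circ t - z) ^+ 2.
  rewrite -exprMn lerXn2r ?nnegrE ?(ltW w0) // (le_trans (ltW w0)) //.
rewrite /poisson mulrA ler_pdivlMr ?exprn_gt0 // mulrAC ler_pdivrMr ?exprn_gt0 //.
have hz0 := onemsqr_cmod_gt0 z1; have hw0 := onemsqr_cmod_gt0 w1.
have c0 : 0 <= cmod (circ t - w) ^+ 2 by rewrite sqr_ge0.
apply: le_trans (ler_wpM2r c0 zw) _.
rewrite (_ : 2 * B * A ^+ 2 * _ * _ = 2 * B * (1 - cmod w ^+ 2) * (A ^+ 2 * cmod (circ t -
  z) ^+ 2)); last by ring.
by apply: ler_wpM2l A2; apply: le_trans zw; exact: ltW.
Qed.

(** A Harnack inequality: every e on the circle is at distance at least 1 - |z| from z, so |e - w|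
    <= (1 + A) |e - z|. *)
Lemma poisson_harnack z w t A B : cmod z < 1 -> cmod w < 1 -> 0 <= A -> 0 <= B ->
  cmod (z - w) <= A * (1 - cmod z) -> 1 - cmod z <= B * (1 - cmod w) ->
  poisson z t <= 2 * B * (1 + A) ^+ 2 * poisson w t.
Proof.
move=> z1 w1 A0 B0 hA hB; apply: poisson_comp => //.
apply: le_trans (cmodBD _ _ z) _; rewrite mulrDl mul1r lerD2l.
by apply: le_trans hA _; rewrite ler_wpM2l // cmod_circB_ge.
Qed.

(** The reciprocal, at [circ t], of the disc automorphism (e - z) / (1 - conj z e); this is the
    number w of the overview. *)
Definition cayley z t : R[i] := (1 - z^*%C * circ t) / (circ t - z).

Lemma circ_mulJ t : circ t * (circ t)^*%C = 1.
Proof. by rewrite mulcJ cmod_circ expr1n. Qed.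

Lemma cayley_numE z t : 1 - z^*%C * circ t = circ t * (circ t - z)^*%C.
Proof. by rewrite conjcB mulrBr circ_mulJ mulrC. Qed.

Lemma cmod_cayley z t : cmod z < 1 -> cmod (cayley z t) = 1.
Proof.
move=> z1; rewrite cmodM cmodV cayley_numE cmodM cmodJ cmod_circ mul1r divff //.
by rewrite gt_eqF // cmod_circB_gt0.
Qed.

Lemma cayleyB z s t : cmod z < 1 ->
  cmod (cayley z s - cayley z t) =
  (1 - cmod z ^+ 2) * cmod (circ s - circ t) /
    (cmod (circ s - z) * cmod (circ t - z)).
Proof.
move=> z1; have sz := circB_neq0 s z1; have tz := circB_neq0 t z1.
have -> : cayley z s - cayley z t =
    (1 - z * z^*%C) * (circ t - circ s) / ((circ s - z) * (circ t - z)).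
  rewrite /cayley; field; exact/andP.
rewrite mulcJ cmodM cmodV !cmodM (cmodB (circ t)) -[1]/(1%:C%C) -rmorphB cmodR.
by rewrite ger0_norm // ltW // onemsqr_cmod_gt0.
Qed.

(* the derivative of the Poisson kernel in the direction v, up to the factor
   2 / (1 - |z|^2) *)
Definition dpoisson z v t : R := complex.Re (v * cayley z t) * poisson z t.

Lemma normr_dpoisson z v t : cmod z < 1 -> `|dpoisson z v t| <= cmod v * poisson z t.
Proof.
move=> z1; have P0 := poisson_gt0 t z1.
rewrite normrM (gtr0_norm P0) ler_pM2r //.
by apply: le_trans (normRe_le_cmod _) _; rewrite cmodM cmod_cayley // mulr1.
Qed.

Lemma poissonC z t : cmod z < 1 -> (poisson z t)%:C%C =
  (1 - z * z^*%C) / ((circ t - z) * (circ t - z)^*%C).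
Proof.
move=> z1; rewrite !mulcJ -[1]/(1%:C%C) -rmorphB.
by rewrite -fmorphV -rmorphM.
Qed.

Lemma poisson_Re z t : cmod z < 1 ->
  poisson z t = complex.Re ((circ t + z) / (circ t - z)).
Proof.
move=> z1; have tz := circB_neq0 t z1.
have tzJ : (circ t - z)^*%C != 0 by rewrite conjc_eq0.
have e : (circ t + z) / (circ t - z) + ((circ t + z) / (circ t - z))^*%C
    = 2 * (poisson z t)%:C%C.
  rewrite poissonC // conjcM conjc_inv.
  have h := circ_mulJ t.
  move: tzJ; rewrite conjcB conjcD => tzJ.
  move: (circ t) ((circ t)^*%C) h tz tzJ => c cb h tz tzJ.
  have -> : (c + z) / (c - z) + (cb + z^*%C) / (cb - z^*%C) =
     2 * (c * cb - z * z^*%C) / ((c - z) * (cb - z^*%C)).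
     by field; rewrite ?tz ?tzJ.
  by rewrite h mulrA.
move: e; rewrite addcJ => /mulfI; rewrite pnatr_eq0 => /(_ isT) e.
exact: (esym (complexI e)).
Qed.

(** Justifies reading [dpoisson] as a derivative: e / (e - z)^2 is half the z-derivative of (e + z)
    / (e - z), whose real part is the Poisson kernel. *)
Lemma dpoisson_kernel z v t : cmod z < 1 ->
  dpoisson z v t = (1 - cmod z ^+ 2) * complex.Re (v * (circ t / (circ t - z) ^+ 2)).
Proof.
move=> z1; rewrite /dpoisson mulrC -!ReZ; congr complex.Re.
have -> : (1 - cmod z ^+ 2)%:C%C = 1 - z * z^*%C by rewrite mulcJ rmorphB.
rewrite poissonC // /cayley cayley_numE.
have tz := circB_neq0 t z1.
have tzJ : (circ t - z)^*%C != 0 by rewrite conjc_eq0.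
by rewrite conjcB in tzJ *; field; rewrite ?tz ?tzJ.
Qed.

(** The remainder of (e + z) / (e - z) is exactly 2 h^2 e / ((e - z)^2 (e - z - h)), and the last
    factor of the denominator is at least (1 - |z|) / 2 in modulus. *)
Lemma poisson_Taylor z h t : cmod z < 1 -> cmod h <= (1 - cmod z) / 2 ->
  `|poisson (z + h) t - poisson z t
     - 2 * complex.Re (h * (circ t / (circ t - z) ^+ 2))|
  <= 4 / (1 - cmod z) ^+ 3 * cmod h ^+ 2.
Proof.
move=> z1 hz; have zh1 : cmod (z + h) < 1 by have := cmodD z h; lra.
have tz := circB_neq0 t z1; have tzh := circB_neq0 t zh1.
have d0 : 0 < 1 - cmod z by rewrite subr_gt0.
rewrite !poisson_Re // -[2](_ : complex.Re 2 = 2) //.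
rewrite (_ : complex.Re 2 * _ = complex.Re (2%:C%C * (h * (circ t / (circ t - z) ^+ 2))));
  last first.
  by rewrite ReZ.
rewrite -!ReB (_ : _ - _ = 2 * h ^+ 2 * circ t * (circ t - z) ^- 2 * (circ t - (z + h))^-1);
  last first.
  have -> : 2%:C%C = 2 :> R[i] by rewrite -(rmorph_nat (real_complex R)).
  by field; rewrite ?tz ?tzh.
apply: le_trans (normRe_le_cmod _) _.
rewrite !cmodM cmod_circ !cmodV cmodM -!expr2 mulr1.
have -> : cmod 2 = 2 :> R by rewrite -(rmorph_nat (real_complex R)) cmodR normr_nat.
have h1 : (1 - cmod z) / 2 <= cmod (circ t - (z + h)).
  by have := cmod_circB_ge (z + h) t; have := cmodD z h; lra.
have h2 := cmod_circB_ge z t.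
rewrite [leRHS](_ : _ = 2 * cmod h ^+ 2 / (1 - cmod z) ^+ 2 * ((1 - cmod z) / 2)^-1);
  last first.
  by field; rewrite gt_eqF.
have c0 := cmod_ge0 h.
apply: ler_pM; rewrite ?invr_ge0 ?cmod_ge0 //.
- by rewrite !mulr_ge0 ?invr_ge0 ?mulr_ge0 ?cmod_ge0.
- rewrite ler_wpM2l ?mulr_ge0 ?exprn_ge0 // lef_pV2 ?posrE ?exprn_gt0 ?cmod_circB_gt0 //.
  by rewrite lerXn2r ?nnegrE ?cmod_ge0 // ltW.
- by rewrite lef_pV2 ?posrE ?(lt_le_trans _ h1) // divr_gt0.
Qed.

Lemma sqr_cmod_circB_radial r s t :
  cmod (circ t - r%:C%C * circ s) ^+ 2 = 1 + r ^+ 2 - 2 * r * cos (2 * pi * (t - s)).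
Proof.
rewrite sqr_cmod mulrBr cosB /circ /= !mul0r subr0 addr0.
have := cos2Dsin2 (2 * pi * s); have := cos2Dsin2 (2 * pi * t).
move: (cos (2 * pi * s)) (sin (2 * pi * s)) (cos (2 * pi * t)) (sin (2 * pi * t)).
move=> c1 s1 c2 s2 h1 h2.
have -> : 1 + r ^+ 2 = c2 ^+ 2 + s2 ^+ 2 + r ^+ 2 * (c1 ^+ 2 + s1 ^+ 2).
  by rewrite h1 h2 mulr1.
ring.
Qed.

Lemma cmod_radial r s : 0 <= r -> cmod (r%:C%C * circ s) = r.
Proof. by move=> r0; rewrite cmodM cmod_circ mulr1 cmodR ger0_norm. Qed.

Lemma poisson_radial r s t : 0 <= r -> poisson (r%:C%C * circ s) t =
  (1 - r ^+ 2) / (1 + r ^+ 2 - 2 * r * cos (2 * pi * (t - s))).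
Proof. by move=> r0; rewrite /poisson cmod_radial // sqr_cmod_circB_radial. Qed.

Lemma dpoisson_radial r s t : 0 <= r < 1 ->
  dpoisson (r%:C%C * circ s) (circ s) t =
  ((1 + r ^+ 2) * cos (2 * pi * (t - s)) - 2 * r)
    / (1 + r ^+ 2 - 2 * r * cos (2 * pi * (t - s)))
  * poisson (r%:C%C * circ s) t.
Proof.
move=> /andP[r0 r1]; have z1 : cmod (r%:C%C * circ s) < 1 by rewrite cmod_radial.
rewrite /dpoisson; congr (_ * _); rewrite -sqr_cmod_circB_radial.
have tz := circB_neq0 t z1; have tz0 := cmod_circB_gt0 t z1.
rewrite /cayley.
have -> : (circ t - r%:C%C * circ s)^-1 =
   ((cmod (circ t - r%:C%C * circ s) ^+ 2)^-1)%:C%C * (circ t - r%:C%C * circ s)^*%C.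
  move: tz; move: (_ - _) => q q0; have qJ0 : q^*%C != 0 by rewrite conjc_eq0.
  have -> : ((cmod q ^+ 2)^-1)%:C%C = (q * q^*%C)^-1 by rewrite mulcJ fmorphV.
  by field; rewrite qJ0 q0.
rewrite mulrA mulrCA ReZ mulrC; congr (_ / _).
rewrite [2 * pi * _]mulrBr cosB conjcB !conjcM conjc_real /circ /=.
have := cos2Dsin2 (2 * pi * s); have := cos2Dsin2 (2 * pi * t).
move: (cos (2 * pi * s)) (sin (2 * pi * s)) (cos (2 * pi * t)) (sin (2 * pi * t)).
move=> c1 s1 c2 s2 h1 h2.
have -> : 2 * r = r * (c1 ^+ 2 + s1 ^+ 2) + r * (c1 ^+ 2 + s1 ^+ 2) * (c2 ^+ 2 + s2 ^+ 2) by
  rewrite h1 h2; ring.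
have -> : (1 + r ^+ 2) * (c2 * c1 + s2 * s1) = (1 + r ^+ 2 * (c1 ^+ 2 + s1 ^+ 2)) * (c2 * c1
  + s2 * s1) by rewrite h2; ring.
ring.
Qed.

(** * Comparison of Poisson kernels along a radius *)

Section RadialStep.
Variables (r a s t : R).
Hypotheses (r01 : 0 <= r < 1) (a01 : 0 <= a < 1).

Let r0 : 0 <= r. Proof. by case/andP: r01. Qed.
Let r1 : r < 1. Proof. by case/andP: r01. Qed.
Let a0 : 0 <= a. Proof. by case/andP: a01. Qed.
Let a1 : a < 1. Proof. by case/andP: a01. Qed.

(** A hyperbolic translation: (1 + r') / (1 - r') is (1 + r) / (1 - r) multiplied by (1 + a) / (1 -
    a). *)
Let r' := (r + a) / (1 + r * a).
Let z := r%:C%C * circ s.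
Let z' := r'%:C%C * circ s.

(** Here [d] is |e - z|^2 and [m / d] is the real part of the rotated w. The ratio P_{z'} / P_z
    equals (1 - a^2) / x with x = [S / d] = 1 + a^2 - 2 a (m / d), which is affine in that real
    part; convexity of 1/x gives the two estimates below. *)
Let p := cos (2 * pi * (t - s)).
Let d := 1 + r ^+ 2 - 2 * r * p.
Let m := (1 + r ^+ 2) * p - 2 * r.
Let S := (1 + a ^+ 2) * d - 2 * a * m.

Let p1 : -1 <= p <= 1. Proof. by rewrite /p cos_geN1 cos_le1. Qed.

Let d_gt0 : 0 < d.
Proof.
have hr0 := r0; have hr1 := r1; have ha0 := a0; have ha1 := a1.
have h1 : 0 < (1 - r) ^+ 2 by rewrite exprn_gt0 //; lra.
have h2 : 0 <= r * (1 - p) by rewrite mulr_ge0 //; have := p1; lra.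
by rewrite /d; nra.
Qed.

Let m_le : - d <= m <= d.
Proof.
have hr0 := r0; have hr1 := r1; have ha0 := a0; have ha1 := a1.
have h1 : 0 <= (1 + r) ^+ 2 * (1 - p) by rewrite mulr_ge0 ?sqr_ge0 //; have := p1; lra.
have h2 : 0 <= (1 - r) ^+ 2 * (1 + p) by rewrite mulr_ge0 ?sqr_ge0 //; have := p1; lra.
by rewrite /d /m; nra.
Qed.

Let S_gt0 : 0 < S.
Proof.
have hr0 := r0; have hr1 := r1; have ha0 := a0; have ha1 := a1.
have := d_gt0; have := m_le; rewrite /S; move: d m => d' m' h h0.
have : 0 < (1 - a) ^+ 2 * d' by rewrite mulr_gt0 // exprn_gt0 //; lra.
nra.
Qed.

Let ra_gt0 : 0 < 1 + r * a. Proof. by have := mulr_ge0 r0 a0; lra. Qed.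

Let poisson_z' : poisson z' t = (1 - r ^+ 2) * (1 - a ^+ 2) / S.
Proof.
have hr0 := r0; have hr1 := r1; have ha0 := a0; have ha1 := a1.
have r'0 : 0 <= r' by rewrite /r' divr_ge0 //; nra.
have ra0 : 1 + r * a != 0 by rewrite gt_eqF.
rewrite /z' poisson_radial // -/p.
have -> : 1 + r' ^+ 2 - 2 * r' * p = S / (1 + r * a) ^+ 2.
  by rewrite /S /d /m /r'; field.
have -> : 1 - r' ^+ 2 = (1 - r ^+ 2) * (1 - a ^+ 2) / (1 + r * a) ^+ 2.
  by rewrite /r'; field.
by field; rewrite ra0 gt_eqF.
Qed.

Let poisson_z : poisson z t = (1 - r ^+ 2) / d.
Proof. by rewrite /z poisson_radial. Qed.

Let dpoisson_z : dpoisson z (circ s) t = (1 - r ^+ 2) * m / d ^+ 2.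
Proof.
have hr0 := r0; have hr1 := r1; have ha0 := a0; have ha1 := a1.
rewrite /z dpoisson_radial // -/z poisson_z -/p -/d -/m.
by field; rewrite gt_eqF.
Qed.

(* tangent line of 1/x at x0 *)
Lemma poisson_step_ge x0 : 0 < x0 ->
  (1 - a ^+ 2) / x0 ^+ 2 * (2 * x0 - (1 + a ^+ 2)) * poisson z t
   + (1 - a ^+ 2) / x0 ^+ 2 * (2 * a) * dpoisson z (circ s) t <= poisson z' t.
Proof.
have hr0 := r0; have hr1 := r1; have ha0 := a0; have ha1 := a1.
move=> x00; have d0 := d_gt0; have S0 := S_gt0.
rewrite poisson_z' poisson_z dpoisson_z -subr_ge0.
have -> : (1 - r ^+ 2) * (1 - a ^+ 2) / S - ((1 - a ^+ 2) / x0 ^+ 2 * (2 * x0 - (1 + a ^+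
  2)) * ((1 - r ^+ 2) / d)
   + (1 - a ^+ 2) / x0 ^+ 2 * (2 * a) * ((1 - r ^+ 2) * m / d ^+ 2)) =
  (1 - r ^+ 2) * (1 - a ^+ 2) * (1 - S / (x0 * d)) ^+ 2 / S.
  rewrite (_ : (1 - a ^+ 2) / x0 ^+ 2 * (2 * a) * ((1 - r ^+ 2) * m / d ^+ 2) =
    (1 - a ^+ 2) / x0 ^+ 2 * ((1 - r ^+ 2) * ((1 + a ^+ 2) * d - S) / d ^+ 2)); last first.
    by rewrite /S; field; rewrite !gt_eqF.
  by move: S0; move: S => S' S'0; field; rewrite !gt_eqF.
have : 0 <= 1 - r ^+ 2 by nra.
have : 0 <= 1 - a ^+ 2 by nra.
by move=> h1 h2; rewrite divr_ge0 ?(ltW S0) // mulr_ge0 ?sqr_ge0 // mulr_ge0.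
Qed.

(* chord of 1/x between (1 - a)^2 and (1 + a)^2 *)
Lemma poisson_step_le :
  poisson z' t <= (1 + a ^+ 2) / (1 - a ^+ 2) * poisson z t
    + 2 * a / (1 - a ^+ 2) * dpoisson z (circ s) t.
Proof.
have hr0 := r0; have hr1 := r1; have ha0 := a0; have ha1 := a1.
have d0 := d_gt0; have S0 := S_gt0; have m1 := m_le.
have r2 : 0 < 1 - r ^+ 2 by nra.
have a2 : 0 < 1 - a ^+ 2 by nra.
rewrite poisson_z' poisson_z dpoisson_z.
have -> : (1 + a ^+ 2) / (1 - a ^+ 2) * ((1 - r ^+ 2) / d)
    + 2 * a / (1 - a ^+ 2) * ((1 - r ^+ 2) * m / d ^+ 2) =
  (1 - r ^+ 2) * ((1 + a ^+ 2) * d + 2 * a * m) / ((1 - a ^+ 2) * d ^+ 2).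
  by field; rewrite !gt_eqF.
rewrite -2!mulrA ler_pM2l // mulrA ler_pdivlMr ?mulr_gt0 ?exprn_gt0 //.
rewrite mulrAC ler_pdivrMr //.
(* This is |m / d| <= 1: x lies between the two end points of the chord. *)
have : m ^+ 2 <= d ^+ 2 by nra.
rewrite /S; move: (d) (m) => d' m' h; have a2' : 0 <= a ^+ 2 by rewrite sqr_ge0.
nra.
Qed.

End RadialStep.

End PoissonKernel.

(** * Integration against sigma *)

Section BoundedMeasurable.
Variable R : realType.
Implicit Types (g h : R -> R) (z v : R[i]).

(** All integrands against sigma belong to this class. It is closed under linear combinations and
    consists of integrable functions because sigma is finite. *)
Definition bounded_measurable g :=
  measurable_fun setT g /\ exists M, forall t, `|g t| <= M.

Lemma bounded_measurable_cst (c : R) : bounded_measurable (fun=> c).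
Proof. by split; [exact: measurable_cst|exists `|c|]. Qed.

Lemma bounded_measurableD g h : bounded_measurable g -> bounded_measurable h ->
  bounded_measurable (fun t => g t + h t).
Proof.
move=> [mg [M gM]] [mh [N hN]]; split; first exact: measurable_funD.
by exists (M + N) => t; apply: le_trans (ler_normD _ _) _; exact: lerD.
Qed.

Lemma bounded_measurableZ g (c : R) : bounded_measurable g ->
  bounded_measurable (fun t => c * g t).
Proof.
move=> [mg [M gM]]; split; first exact: measurable_funM.
by exists (`|c| * M) => t; rewrite normrM ler_wpM2l.
Qed.

Lemma bounded_measurable_sum (n : nat) (g : nat -> R -> R) :
  (forall j, bounded_measurable (g j)) ->
  bounded_measurable (fun t => \sum_(j < n) g j t).
Proof.
move=> gb; elim: n => [|n IH].
  rewrite (_ : (fun _ => _) = fun=> 0); first exact: bounded_measurable_cst.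
  by apply/funext => t; rewrite big_ord0.
rewrite (_ : (fun _ => _) = fun t => \sum_(j < n) g j t + g n t).
  exact: bounded_measurableD.
by apply/funext => t; rewrite big_ord_recr.
Qed.

Lemma bounded_measurable_indic (A : set R) : measurable A ->
  bounded_measurable (\1_A).
Proof.
move=> mA; split; first exact: measurable_indic.
by exists 1 => t; rewrite indicE; case: (_ \in _); rewrite ?normr1 ?normr0.
Qed.

Lemma continuous_addf g h : continuous g -> continuous h ->
  continuous (fun t => g t + h t).
Proof. by move=> cg ch t; apply: cvgD; [exact: cg|exact: ch]. Qed.

Lemma continuous_oppf g : continuous g -> continuous (fun t => - g t).
Proof. by move=> cg t; apply: cvgN; exact: cg. Qed.

Lemma continuous_mulf g h : continuous g -> continuous h ->
  continuous (fun t => g t * h t).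
Proof. by move=> cg ch t; apply: cvgM; [exact: cg|exact: ch]. Qed.

Lemma continuous_invf g : continuous g -> (forall t, g t != 0) ->
  continuous (fun t => (g t)^-1).
Proof. by move=> cg g0 t; apply: cvgV => //; exact: cg. Qed.

Lemma continuous_cos2pi : continuous (fun t : R => cos (2 * pi * t)).
Proof.
move=> t; apply: (@continuous_comp _ _ _ (fun t : R => 2 * pi * t) (@cos R)).
  exact: mulrl_continuous.
exact: continuous_cos.
Qed.

Lemma continuous_sin2pi : continuous (fun t : R => sin (2 * pi * t)).
Proof.
move=> t; apply: (@continuous_comp _ _ _ (fun t : R => 2 * pi * t) (@sin R)).
  exact: mulrl_continuous.
exact: continuous_sin.
Qed.

Ltac continuity := lazymatch goal with
  | |- continuous (fun t => GRing.add (@?a t) (@?b t)) =>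
      apply (@continuous_addf a b); continuity
  | |- continuous (fun t => GRing.mul (@?a t) (@?b t)) =>
      apply (@continuous_mulf a b); continuity
  | |- continuous (fun t => GRing.opp (@?a t)) =>
      apply (@continuous_oppf a); continuity
  | |- continuous (fun t => cos _) => exact continuous_cos2pi
  | |- continuous (fun t => sin _) => exact continuous_sin2pi
  | _ => exact: cst_continuous
  end.

Lemma continuous_sqr_cmod_circB z :
  continuous (fun t : R => cmod (circ t - z) ^+ 2).
Proof.
rewrite (_ : (fun _ => _) = fun t =>
   (cos (2 * pi * t) - complex.Re z) * (cos (2 * pi * t) - complex.Re z) +
   (sin (2 * pi * t) - complex.Im z) * (sin (2 * pi * t) - complex.Im z)); last first.
  by apply/funext => t; rewrite sqr_cmod -!expr2; case: z.
by continuity.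
Qed.

Lemma continuous_poisson z : cmod z < 1 -> continuous (poisson z).
Proof.
move=> z1; apply: continuous_mulf; first exact: cst_continuous.
apply: continuous_invf; first exact: continuous_sqr_cmod_circB.
by move=> t; rewrite gt_eqF // exprn_gt0 // cmod_circB_gt0.
Qed.

Lemma bounded_measurable_poisson z : cmod z < 1 -> bounded_measurable (poisson z).
Proof.
move=> z1; split; last first.
  by exists (2 / (1 - cmod z)) => t; rewrite gtr0_norm ?poisson_gt0 ?poisson_le.
by apply: continuous_measurable_fun; exact: continuous_poisson.
Qed.

Lemma continuous_dpoisson z v : cmod z < 1 -> continuous (dpoisson z v).
Proof.
move=> z1.
(* Writing 1 / q as conj q / |q|^2 leaves real polynomials in cos and sin, divided by a positive
   continuous function. *)
have -> : dpoisson z v = fun t =>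
    complex.Re (v * ((1 - z^*%C * circ t) * (circ t - z)^*%C))
     * (cmod (circ t - z) ^+ 2)^-1 * poisson z t.
  apply/funext => t; rewrite /dpoisson /cayley; congr (_ * _).
  rewrite [RHS]mulrC -ReZ; congr complex.Re.
  have tz := circB_neq0 t z1; have tzJ : (circ t - z)^*%C != 0 by rewrite conjc_eq0.
  move: tz tzJ; move: (circ t - z) => q q0 qJ0.
  have -> : ((cmod q ^+ 2)^-1)%:C%C = (q * q^*%C)^-1 by rewrite mulcJ fmorphV.
  by field; rewrite q0 qJ0.
apply: continuous_mulf; last exact: continuous_poisson.
apply: continuous_mulf; last first.
  apply: continuous_invf; first exact: continuous_sqr_cmod_circB.
  by move=> t; rewrite gt_eqF // exprn_gt0 // cmod_circB_gt0.
by case: z {z1} => x y; case: v => v1 v2; rewrite /circ /=; continuity.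
Qed.

Lemma bounded_measurable_dpoisson z v : cmod z < 1 ->
  bounded_measurable (dpoisson z v).
Proof.
move=> z1; split.
  by apply: continuous_measurable_fun; exact: continuous_dpoisson.
exists (cmod v * (2 / (1 - cmod z))) => t; apply: le_trans (normr_dpoisson v t z1) _.
by rewrite ler_wpM2l ?cmod_ge0 ?poisson_le.
Qed.

End BoundedMeasurable.

Section FiniteMeasure.
Variables (R : realType) (sigma : {measure set R -> \bar R}).
Hypothesis sigma_fin : (sigma setT < +oo)%E.
Implicit Types (g h : R -> R).

Local Notation E g := (\int[sigma]_(t in `[0%R, 1%R[) g t).

Let mI : measurable (`[0%R, 1%R[%classic : set R). Proof. exact: measurable_itv. Qed.

Lemma finite_measureS (A : set R) : measurable A -> (sigma A < +oo)%E.
Proof.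
by move=> mA; apply: le_lt_trans sigma_fin; apply: le_measure; rewrite ?inE.
Qed.

Lemma bounded_measurable_integrable g : bounded_measurable g ->
  sigma.-integrable `[0%R, 1%R[ (EFin \o g).
Proof.
move=> [mg [M gM]]; apply: measurable_bounded_integrable => //.
- exact: finite_measureS.
- exact: measurable_funTS.
- exists M; split; first exact: num_real.
  by move=> x Mx t _ /=; apply: le_trans (gM t) _; exact: ltW.
Qed.

Lemma bounded_RintegralD g h : bounded_measurable g -> bounded_measurable h ->
  E (fun t => g t + h t) = E g + E h.
Proof. by move=> ? ?; apply: RintegralD => //; exact: bounded_measurable_integrable. Qed.

Lemma bounded_RintegralZl g (c : R) : bounded_measurable g -> E (fun t => c * g t) = c * E g.
Proof. by move=> ?; apply: RintegralZl => //; exact: bounded_measurable_integrable. Qed.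

Lemma Rintegral01_cst (c : R) : E (fun=> c) = c * fine (sigma `[0%R, 1%R[%classic).
Proof. exact: Rintegral_cst. Qed.

Lemma bounded_le_Rintegral g h : bounded_measurable g -> bounded_measurable h ->
  (forall t, 0 <= t < 1 -> g t <= h t) -> E g <= E h.
Proof.
move=> bg bh gh; apply: le_Rintegral => //; try exact: bounded_measurable_integrable.
Qed.

Lemma bounded_Rintegral_sum (n : nat) (g : nat -> R -> R) : (forall j, bounded_measurable (g
  j)) ->
  E (fun t => \sum_(j < n) g j t) = \sum_(j < n) E (g j).
Proof.
move=> gb; elim: n => [|n IH].
  rewrite big_ord0 (_ : (fun _ => _) = fun=> 0); first by rewrite Rintegral01_cst mul0r.
  by apply/funext => t; rewrite big_ord0.
rewrite big_ord_recr /= -IH -bounded_RintegralD //; last exact: bounded_measurable_sum.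
by congr (Rintegral _ _ _); apply/funext => t; rewrite big_ord_recr.
Qed.

Lemma Rintegral01_indic (A : set R) : measurable A -> A `<=` `[0%R, 1%R[ ->
  E (\1_A : R -> R) = fine (sigma A).
Proof.
move=> mA A01; rewrite /Rintegral integral_indic //.
by congr (fine (sigma _)); exact/setIidl.
Qed.

End FiniteMeasure.

(** * Arcs described by the angular offset from their midpoint *)

Section Arcs.
Variable R : realType.
Implicit Types (a l t : R).

Lemma measurable_circ_arc a l : measurable (circ_arc a l).
Proof.
rewrite (_ : circ_arc a l =
  `[0, 1[ `&` \bigcup_(k : int) `[a - k%:~R, a + l - k%:~R]%classic).
  apply: measurableI => //; apply: countable_bigcupT_measurable => [|k].
    exact: countableP.
  exact: measurable_itv.
apply/seteqP; split=> t /=; rewrite in_itv /=.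
  move=> [t01 [k /andP[h1 h2]]]; split=> //; exists k => //=.
  by rewrite in_itv /=; apply/andP; split; lra.
move=> [t01 [k _ /=]]; rewrite in_itv /= => /andP[h1 h2]; split=> //; exists k.
by apply/andP; split; lra.
Qed.

Lemma circ_arc_sub a l : circ_arc a l `<=` `[0%R, 1%R[.
Proof. by move=> t [t01 _]; rewrite /= in_itv. Qed.

Lemma circ_arc_notin a l t : 0 <= t < 1 -> ~ circ_arc a l t ->
  exists d, [/\ `|d| <= 1 / 2, l / 2 < `|d| & circ t = circ (a + l / 2 + d)].
Proof.
move=> t01 nt; have [k tk] := near_int t (a + l / 2).
exists (t + k%:~R - (a + l / 2)); split=> //; last by rewrite addrC subrK circD_int.
rewrite ltNge; apply/negP; rewrite ler_norml => /andP[h1 h2]; apply: nt; split=> //.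
by exists k; apply/andP; split; lra.
Qed.

Lemma circ_arc_in a l t : circ_arc a l t ->
  exists d, `|d| <= l / 2 /\ circ t = circ (a + l / 2 + d).
Proof.
move=> [_ [k /andP[h1 h2]]]; exists (t + k%:~R - (a + l / 2)).
rewrite (addrC (a + _)) subrK circD_int ler_norml; split=> //.
by apply/andP; split; lra.
Qed.

End Arcs.

(** * The hyperbolic derivative as a barycentre *)

Section ComplexDerivative.
Variable R : realType.

(** The scalars of [derivable] are complex here, so direction 1 already yields the full complex
    derivative; only the conversion to real epsilon and delta is at stake. *)
Lemma complex_deriveP (f : R[i] -> R[i]) (z : R[i]) :
  derivable (f : R[i]^o -> R[i]^o) z 1 -> forall e : R, 0 < e ->
  exists2 d : R, 0 < d & forall h, cmod h < d ->
    cmod (f (z + h) - f z - h * 'D_1 (f : R[i]^o -> R[i]^o) z) <= e * cmod h.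
Proof.
move=> df e e0.
have /cvgrPdist_lt /(_ e%:C%C) := df.
rewrite ltcR => /(_ e0) [d /= d0 hd].
have /complex_realP[d' dE] : d \is Num.real by apply: gtr0_real.
exists d'; first by rewrite dE ltcR in d0.
move=> h hd'; have [->|h0] := eqVneq h 0.
  by rewrite addr0 subrr mul0r subrr cmod0 mulr0.
have := hd h; rewrite /ball_ /= sub0r normrN dE normcE_cmod ltcR => /(_ hd' h0).
rewrite /= normcE_cmod ltcR.
set D := 'D_1 (f : R[i]^o -> R[i]^o) z; rewrite -[lim _]/D; move: D => D.
rewrite -[h *: 1]/(h * 1) mulr1 (addrC h) => hlt.
have -> : f (z + h) - f z - h * D = - h * (D - h^-1 * (f (z + h) - f z)).
  by rewrite mulrBr mulNr mulrA mulNr mulfV // mulN1r opprK addrC.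
rewrite cmodM cmodN mulrC ler_wpM2r ?cmod_ge0 //.
exact: ltW.
Qed.

End ComplexDerivative.

Lemma eq0_of_normr_le_small (R : realType) (D M : R) :
  (forall e, 0 < e <= 1 -> `|D| <= M * e) -> D = 0.
Proof.
move=> h; apply/eqP; rewrite -normr_le0; apply/ler_addgt0Pr => e e0.
have M0 : 0 <= M by have := h 1; rewrite mulr1 => /(_ _); have := normr_ge0 D; lra.
have [Me|Me] := leP (M + 1) e.
  by have := h 1; rewrite mulr1 => /(_ _); lra.
have := h (e / (M + 1)) => /(_ _); rewrite divr_gt0 ?ler_pdivrMr ?mul1r ?ltr_wpDl //=.
rewrite (ltW Me) => /(_ isT) /le_trans; apply.
by rewrite add0r mulrA ler_pdivrMr ?ltr_wpDl // mulrC ler_pM2l //; lra.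
Qed.

Section Clark.
Variables (R : realType) (f : R[i] -> R[i]) (alpha : R[i])
  (sigma : {measure set R -> \bar R}).
Hypotheses (fD : analytic_self_map f) (alpha1 : cmod alpha = 1)
  (fsigma : clark_measure f alpha sigma).

Local Notation E g := (\int[sigma]_(t in `[0%R, 1%R[) g t).
Local Notation u := (poisson_int sigma).
Local Notation df z := ('D_1 (f : R[i]^o -> R[i]^o) z).

Lemma clark_finite : (sigma setT < +oo)%E. Proof. by case: fsigma => _ []. Qed.

Lemma exists_alpha : exists s, alpha = circ s.
Proof. by have [s] := polar alpha; rewrite alpha1 mul1r => ->; exists s. Qed.

(** The left side of the Clark identity is itself a Poisson kernel, taken at the point [f z] and
    with pole alpha. *)
Lemma poisson_int_clark s z : alpha = circ s -> cmod z < 1 -> u z = poisson (f z) s.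
Proof.
move=> alphaE z1; have [_ [_ /(_ z z1)]] := fsigma.
by rewrite /poisson_int => <-; rewrite /poisson alphaE.
Qed.

Lemma poisson_int_gt0 z : cmod z < 1 -> 0 < u z.
Proof.
move=> z1; have [s /poisson_int_clark ->//] := exists_alpha.
by apply: poisson_gt0; have [] := fD z1.
Qed.

(** The remainder in [poisson_Taylor] is uniform in t, so the expansion can be integrated against
    sigma. *)
Lemma poisson_int_Taylor z h : cmod z < 1 -> cmod h <= (1 - cmod z) / 2 ->
  `|u (z + h) - u z - 2 / (1 - cmod z ^+ 2) * E (dpoisson z h)|
   <= 4 / (1 - cmod z) ^+ 3 * cmod h ^+ 2 * fine (sigma `[0%R, 1%R[%classic).
Proof.
move=> z1 hz; have zh1 : cmod (z + h) < 1 by have := cmodD z h; lra.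
have sf := clark_finite.
have bP := bounded_measurable_poisson z1; have bPh := bounded_measurable_poisson zh1.
have bd := bounded_measurable_dpoisson h z1.
set c := 2 / _; set C := _ * cmod h ^+ 2.
have key t : `|poisson (z + h) t + (- 1) * poisson z t + (- c) * dpoisson z h t| <= C.
  have -> : poisson (z + h) t + -1 * poisson z t + - c * dpoisson z h t =
    poisson (z + h) t - poisson z t - 2 * complex.Re (h * (circ t / (circ t - z) ^+ 2)).
    rewrite dpoisson_kernel // mulN1r mulNr; congr (_ - _).
    by rewrite [LHS]mulrA; congr (_ * _); rewrite /c divfK // gt_eqF // onemsqr_cmod_gt0.
  exact: poisson_Taylor.
have bZ1 := bounded_measurableZ (-1) bP; have bZc := bounded_measurableZ (- c) bd.
have bD := bounded_measurableD bPh bZ1.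
have bDD := bounded_measurableD bD bZc.
have <- : E (fun t => poisson (z + h) t + (- 1) * poisson z t + (- c) * dpoisson z h t)
    = u (z + h) - u z - c * E (dpoisson z h).
  by rewrite (bounded_RintegralD sf bD bZc) (bounded_RintegralD sf bPh bZ1)
    (bounded_RintegralZl sf (-1) bP) (bounded_RintegralZl sf (- c) bd) mulN1r mulNr.
rewrite ler_norml -mulNr -!(Rintegral01_cst sigma); apply/andP; split;
  apply: bounded_le_Rintegral => //;
  try exact: bounded_measurable_cst.
- by move=> t _; have := key t; rewrite ler_norml => /andP[].
- by move=> t _; have := key t; rewrite ler_norml => /andP[].
Qed.

(** Both sides are (1 - |z|^2) / 2 times the derivative of u at z in direction v, computed on the
    left under the integral and on the right by the chain rule through u = P_{f(z)}(alpha). The two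
    first-order expansions are compared along the increment [x * v] with x small. *)
Lemma E_dpoisson s z v : alpha = circ s -> cmod z < 1 -> cmod v = 1 ->
  E (dpoisson z v) =
  (1 - cmod z ^+ 2) * complex.Re (v * (df z * (circ s / (circ s - f z) ^+ 2))).
Proof.
move=> alphaE z1 v1.
have [w1 dfz] := fD z1.
set w := f z in w1 *; set K := circ s / _.
have z2 := onemsqr_cmod_gt0 z1.
set S := fine (sigma `[0%R, 1%R[%classic).
suff : E (dpoisson z v) / (1 - cmod z ^+ 2) - complex.Re (v * (df z * K)) = 0.
  by move/eqP; rewrite subr_eq0 => /eqP <-; rewrite mulrC divfK // gt_eqF.
set D := (X in X = 0).
pose C1 := 4 / (1 - cmod z) ^+ 3 * S.
pose C2 := 4 / (1 - cmod w) ^+ 3 * (cmod (df z) + 1) ^+ 2.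
apply: (@eq0_of_normr_le_small _ _ (C1 + C2 + 2 * cmod K)) => e /andP[e0 e1].
have [d d0 hd] := complex_deriveP dfz e0.
have zp : 0 < 1 - cmod z by rewrite subr_gt0.
have wp : 0 < 1 - cmod w by rewrite subr_gt0.
pose m := cmod (df z) + 1.
have m0 : 0 < m by rewrite ltr_wpDl // cmod_ge0.
(* The increment must be admissible for the derivative of f and for both Taylor expansions; [x <= e]
   turns the quadratic errors into O(e x). *)
have [x [x0 xd xe xz xw]] : exists x, [/\ 0 < x, x < d, x <= e, x <= (1 - cmod z) / 2 &
    m * x <= (1 - cmod w) / 2].
  exists (Num.min (d / 2) (Num.min e (Num.min ((1 - cmod z) / 2) ((1 - cmod w) / 2 / m)))).
  rewrite !lt_min !divr_gt0 //= e0 /=.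
  split=> //.
  - by rewrite gt_min ltr_pdivrMr // ltr_pMr // ltr1n.
  - by rewrite !ge_min ?lexx ?orbT.
  - by rewrite !ge_min ?lexx ?orbT.
  - by rewrite -ler_pdivlMl // [m^-1 * _]mulrC !ge_min ?lexx ?orbT.
pose h : R[i] := x%:C%C * v.
have hx : cmod h = x by rewrite cmodM v1 mulr1 cmodR gtr0_norm.
pose k := f (z + h) - w.
have hk : cmod (k - h * df z) <= e * x by rewrite -hx; apply: hd; rewrite hx.
have kx : cmod k <= m * x.
  rewrite -(subrK (h * df z) k); apply: le_trans (cmodD _ _) _.
  rewrite cmodM hx /m; have := cmod_ge0 (df z); nra.
have zh1 : cmod (z + h) < 1 by have := cmodD z h; rewrite hx; lra.
have T1 := @poisson_int_Taylor z h z1; rewrite hx in T1.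
have {T1} := T1 xz.
rewrite (poisson_int_clark alphaE z1) (poisson_int_clark alphaE zh1).
have -> : E (dpoisson z h) = x * E (dpoisson z v).
  rewrite -(bounded_RintegralZl clark_finite) //; last exact: bounded_measurable_dpoisson.
  congr (Rintegral _ _ _); apply/funext => t.
  by rewrite /dpoisson /h -[x%:C%C * _ * _]mulrA ReZ [RHS]mulrA.
have := @poisson_Taylor _ w k s w1 (le_trans kx xw).
rewrite -/K (_ : w + k = f (z + h)); last by rewrite /k addrC subrK.
have kK : `|complex.Re (k * K) - x * complex.Re (v * (df z * K))| <= e * x * cmod K.
  rewrite -ReZ -ReB; apply: le_trans (normRe_le_cmod _) _.
  rewrite (_ : _ - _ = (k - h * df z) * K); last by rewrite /h; ring.
  by rewrite cmodM ler_wpM2r ?cmod_ge0.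
have kk : 4 / (1 - cmod w) ^+ 3 * cmod k ^+ 2 <= C2 * x ^+ 2.
  rewrite /C2 -[leRHS]mulrA -exprMn ler_wpM2l ?divr_ge0 ?exprn_ge0 ?(ltW wp) //.
  by rewrite lerXn2r ?nnegrE ?cmod_ge0 // mulr_ge0 // ltW.
move: (poisson (f (z + h)) s) (poisson w s) => p1 p2 h2 h1.
have {}h2 := le_trans h2 kk.
have C10 : 0 <= C1 by rewrite mulr_ge0 ?divr_ge0 ?exprn_ge0 ?fine_ge0 // ltW.
have C20 : 0 <= C2 by rewrite mulr_ge0 ?divr_ge0 ?exprn_ge0 ?(ltW m0) // ltW.
have K0 := cmod_ge0 K.
have {}h1 : `|p1 - p2 - 2 * x * (E (dpoisson z v) / (1 - cmod z ^+ 2))| <= C1 * x ^+ 2.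
  rewrite (_ : C1 * _ = 4 / (1 - cmod z) ^+ 3 * x ^+ 2 * S); last by rewrite /C1; ring.
  by move: h1; rewrite (_ : 2 / (1 - cmod z ^+ 2) * (x * _) = 2 * x * (E (dpoisson z v) / (1
    - cmod z ^+ 2))) //; field; rewrite gt_eqF.
move: h1 h2 kK; rewrite /D => {kk}.
move: (_ / _) (complex.Re (k * K)) (complex.Re (v * (df z * K))) C10 C20 K0.
move: C1 C2 (cmod K) => {}C1 {}C2 cK A B F C10 C20 K0 h1 h2 h3.
have : 2 * x * `|A - F| <= C1 * x ^+ 2 + C2 * x ^+ 2 + 2 * e * x * cK.
  rewrite -[2 * x]gtr0_norm ?mulr_gt0 // -normrM.
  move: h1 h2 h3; rewrite !ler_norml => /andP[? ?] /andP[? ?] /andP[? ?].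
  by apply/andP; split; lra.
rewrite (_ : _ + 2 * e * x * cK = x * ((C1 + C2) * x + 2 * e * cK)); last by ring.
rewrite [2 * x]mulrC -[x * 2 * _]mulrA ler_pM2l // => h4.
have : (C1 + C2) * x <= (C1 + C2) * e by rewrite ler_wpM2l // addr_ge0.
have := normr_ge0 (A - F); lra.
Qed.

(** The factor 1 - |f(z)|^2 of u cancels the denominator of the hyperbolic derivative, leaving
    |f'(z)| / |alpha - f(z)|^2. *)
Lemma hyp_deriv_poisson_int s z : alpha = circ s -> cmod z < 1 ->
  hyp_deriv f z * u z =
  (1 - cmod z ^+ 2) * cmod (df z * (circ s / (circ s - f z) ^+ 2)).
Proof.
move=> alphaE z1; have [w1 _] := fD z1.
rewrite (poisson_int_clark alphaE z1) /hyp_deriv /poisson.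
rewrite !cmodM cmodV cmod_circ expr2 cmodM mul1r.
have w2 := onemsqr_cmod_gt0 w1; have w3 := cmod_circB_gt0 s w1.
by field; rewrite !gt_eqF.
Qed.

(** Together with [exists_E_dpoisson], this says that D_h(f)(z) u(z) is the maximum of the integral
    of [dpoisson z v] over unimodular v, that is, the modulus of the integral of w P_z. *)
Lemma E_dpoisson_le z v : cmod z < 1 -> cmod v = 1 ->
  E (dpoisson z v) <= hyp_deriv f z * u z.
Proof.
move=> z1 v1; have [s alphaE] := exists_alpha.
rewrite (E_dpoisson alphaE) // (hyp_deriv_poisson_int alphaE) //.
rewrite ler_pM2l ?onemsqr_cmod_gt0 //.
by apply: le_trans (Re_le_cmod _) _; rewrite cmodM v1 mul1r.
Qed.

Lemma exists_E_dpoisson z : cmod z < 1 ->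
  exists v, cmod v = 1 /\ E (dpoisson z v) = hyp_deriv f z * u z.
Proof.
move=> z1; have [s alphaE] := exists_alpha.
have [v [v1 hv]] := exists_unimodular (df z * (circ s / (circ s - f z) ^+ 2)).
exists v; split=> //.
by rewrite (E_dpoisson alphaE) // (hyp_deriv_poisson_int alphaE) // hv.
Qed.

End Clark.

(** * Growth of u along radii *)

Section Growth.
Variables (R : realType) (sigma : {measure set R -> \bar R}).
Hypothesis sigma_fin : (sigma setT < +oo)%E.
Implicit Types (z w v : R[i]) (r s t x X : R).

Local Notation E g := (\int[sigma]_(t in `[0%R, 1%R[) g t).
Local Notation u := (poisson_int sigma).

Lemma poisson_int_ge0 z : cmod z < 1 -> 0 <= u z.
Proof.
by move=> z1; apply: Rintegral_ge0 => t _; apply/ltW; exact: poisson_gt0.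
Qed.

Lemma poisson_int_harnack z w A B : cmod z < 1 -> cmod w < 1 -> 0 <= A -> 0 <= B ->
  cmod (z - w) <= A * (1 - cmod z) -> 1 - cmod z <= B * (1 - cmod w) ->
  u z <= 2 * B * (1 + A) ^+ 2 * u w.
Proof.
move=> z1 w1 A0 B0 hA hB; have bw := bounded_measurable_poisson w1.
rewrite -(bounded_RintegralZl sigma_fin _ bw); apply: bounded_le_Rintegral => //.
- exact: bounded_measurable_poisson.
- exact: bounded_measurableZ.
- by move=> t _; exact: poisson_harnack.
Qed.

(** Charges the part of an integral on an arc to the mass of the arc and the rest to u at a
    reference point. The coefficient [b] may have either sign, so it also serves to subtract
    mass. *)
Lemma poisson_int_indic_comp (A : set R) (g : R -> R) (w : R[i]) (b c : R) :
  measurable A -> A `<=` `[0%R, 1%R[ -> bounded_measurable g -> cmod w < 1 ->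
  (forall t, 0 <= t < 1 -> g t <= b * \1_A t + c * poisson w t) ->
  E g <= b * fine (sigma A) + c * u w.
Proof.
move=> mA A01 bg w1 h.
have bA := bounded_measurable_indic mA; have bw := bounded_measurable_poisson w1.
rewrite -(Rintegral01_indic sigma mA A01) -(bounded_RintegralZl sigma_fin b bA)
  -(bounded_RintegralZl sigma_fin c bw).
rewrite -(bounded_RintegralD sigma_fin (bounded_measurableZ b bA) (bounded_measurableZ c bw)).
by apply: bounded_le_Rintegral => //; apply: bounded_measurableD; exact: bounded_measurableZ.
Qed.

Variable k : R.
Hypothesis k01 : 0 <= k < 1.
Hypothesis dpoisson_le : forall z v, cmod z < 1 -> cmod v = 1 ->
  E (dpoisson z v) <= k * u z.

Lemma E_dpoisson_ge z v : cmod z < 1 -> cmod v = 1 -> - (k * u z) <= E (dpoisson z v).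
Proof.
move=> z1 v1; rewrite lerNl.
have <- : E (dpoisson z (- v)) = - E (dpoisson z v).
  rewrite -[RHS]mulN1r -(bounded_RintegralZl sigma_fin (-1) (bounded_measurable_dpoisson v
    z1)).
  congr (Rintegral _ _ _); apply/funext => t.
  by rewrite /dpoisson !mulNr mul1r; case: (v * _) => ? ? /=; rewrite mulNr.
by apply: dpoisson_le => //; rewrite cmodN.
Qed.

(** The value at a = 1/3 of (1 + a^2 + 2 a k) / (1 - a^2), the factor produced by the chord
    estimate; a = 1/3 is the translation that doubles (1 + r) / (1 - r). It is below 2 because k <
    1. *)
Definition growth_rate := (5 + 3 * k) / 4.
Local Notation L := growth_rate.

Lemma growth_rate_bounds : 1 <= L < 2.
Proof. by case/andP: k01 => k0 k1; rewrite /growth_rate; apply/andP; split; lra. Qed.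

Lemma poisson_int_step r a s : 0 <= r < 1 -> 0 <= a <= 1 / 3 ->
  let z := r%:C%C * circ s in let z' := ((r + a) / (1 + r * a))%:C%C * circ s in
  u z' <= L * u z /\ u z <= L * u z'.
Proof.
move=> r01 /andP[a0 a3] z z'; have [/andP[r0 r1] /andP[k0 k1]] := (r01, k01).
have a01 : 0 <= a < 1 by rewrite a0 /=; lra.
have ra0 : 0 < 1 + r * a by have := mulr_ge0 r0 a0; lra.
have z1 : cmod z < 1 by rewrite cmod_radial.
have r'0 : 0 <= (r + a) / (1 + r * a) by apply: divr_ge0; [exact: addr_ge0|exact: ltW].
have z'1 : cmod z' < 1.
  rewrite cmod_radial // ltr_pdivrMr // mul1r.
  have : 0 < (1 - r) * (1 - a) by rewrite mulr_gt0 ?subr_gt0 //; case/andP: a01.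
  lra.
have bz := bounded_measurable_poisson z1.
have bz' := bounded_measurable_poisson z'1.
have bd := bounded_measurable_dpoisson (circ s) z1.
have u0 := poisson_int_ge0 z1; have u'0 := poisson_int_ge0 z'1.
have d1 := dpoisson_le z1 (cmod_circ s).
have d2 := E_dpoisson_ge z1 (cmod_circ s).
have a2 : 0 < 1 - a ^+ 2 by nra.
have lin (b c : R) : E (fun t => b * poisson z t + c * dpoisson z (circ s) t)
    = b * u z + c * E (dpoisson z (circ s)).
  rewrite (bounded_RintegralD sigma_fin (bounded_measurableZ b bz) (bounded_measurableZ c bd)).
  by rewrite (bounded_RintegralZl sigma_fin b bz) (bounded_RintegralZl sigma_fin c bd).
have blin b c := bounded_measurableD (bounded_measurableZ b bz) (bounded_measurableZ c bd).
(* Four times the difference of the two sides has the factor 1 - 3 a. *)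
have key : 1 + a ^+ 2 + 2 * a * k <= L * (1 - a ^+ 2).
  have : 0 <= (1 - 3 * a) * (1 + 3 * a) + k * ((3 + a) * (1 - 3 * a)).
    by rewrite addr_ge0 // !mulr_ge0 //; lra.
  by rewrite /growth_rate; lra.
split.
  apply: le_trans (_ : (1 + a ^+ 2 + 2 * a * k) / (1 - a ^+ 2) * u z <= _); last first.
    by rewrite ler_wpM2r // ler_pdivrMr.
  have : u z' <= (1 + a ^+ 2) / (1 - a ^+ 2) * u z + 2 * a / (1 - a ^+ 2) * E (dpoisson z
    (circ s)).
    by rewrite -lin; apply: bounded_le_Rintegral => // t _; exact: poisson_step_le.
  move/le_trans; apply.
  rewrite -![_ / _ * _]mulrAC -mulrDl ler_pM2r ?invr_gt0 //.
  by nra.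
(* The tangent is taken where m / d = -k, the smallest mean value that the bound on [dpoisson]
   allows; there it gives exactly (1 - a^2) / x0. *)
set x0 := 1 + a ^+ 2 + 2 * a * k in key.
have x00 : 0 < x0 by rewrite /x0; have := sqr_ge0 a; nra.
have : (1 - a ^+ 2) / x0 ^+ 2 * (2 * x0 - (1 + a ^+ 2)) * u z
   + (1 - a ^+ 2) / x0 ^+ 2 * (2 * a) * E (dpoisson z (circ s)) <= u z'.
  by rewrite -lin; apply: bounded_le_Rintegral => // t _; exact: poisson_step_ge.
have h1 : (1 - a ^+ 2) / x0 * u z <= (1 - a ^+ 2) / x0 ^+ 2 * (2 * x0 - (1 + a ^+ 2)) * u z
   + (1 - a ^+ 2) / x0 ^+ 2 * (2 * a) * E (dpoisson z (circ s)).
  rewrite (_ : (1 - a ^+ 2) / x0 = (1 - a ^+ 2) / x0 ^+ 2 * x0); last first.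
    by field; rewrite gt_eqF.
  rewrite -!mulrA -!mulrDr ler_pM2l // ler_pM2l ?invr_gt0 ?exprn_gt0 //.
  by rewrite /x0; nra.
move=> /(le_trans h1) h2.
have /andP[L1 _] := growth_rate_bounds.
apply: le_trans (_ : L * ((1 - a ^+ 2) / x0 * u z) <= _); last by rewrite ler_wpM2l //; lra.
by rewrite mulrA ler_peMl // mulrA ler_pdivlMr // mul1r.
Qed.

(** Inverse of r |-> (1 + r) / (1 - r), the exponential of the hyperbolic distance from 0 to r for
    the metric 2 |dz| / (1 - |z|^2). Doubling x is thus a step of fixed hyperbolic length. *)
Definition hrad x : R := (x - 1) / (x + 1).

Lemma hrad_bounds x : 1 <= x -> 0 <= hrad x < 1.
Proof.
move=> x1; rewrite /hrad divr_ge0 ?subr_ge0 // ?ltr_pdivrMr ?mul1r; lra.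
Qed.

Lemma onem_hrad x : 1 <= x -> 1 - hrad x = 2 / (x + 1).
Proof. by move=> x1; rewrite /hrad; field; rewrite gt_eqF //; lra. Qed.

Lemma poisson_int_double x X s : 1 <= x -> x <= X -> X <= 2 * x ->
  let z := (hrad x)%:C%C * circ s in let z' := (hrad X)%:C%C * circ s in
  u z' <= L * u z /\ u z <= L * u z'.
Proof.
move=> x1 xX X2 z z'; have Xx : 0 < X + x by lra.
(* The translation that carries [hrad x] to [hrad X]; it is at most 1/3 exactly when X <= 2 x. *)
have a01 : 0 <= (X - x) / (X + x) <= 1 / 3.
  by apply/andP; split; [apply: divr_ge0; lra|rewrite ler_pdivrMr //; lra].
have := poisson_int_step s (hrad_bounds x1) a01.
rewrite (_ : (hrad x + _) / _ = hrad X) //.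
by rewrite /hrad; field; rewrite !gt_eqF //; nra.
Qed.

Lemma poisson_int_growth n x X s : 1 <= x -> x <= X -> X <= 2 ^+ n * x ->
  let z := (hrad x)%:C%C * circ s in let z' := (hrad X)%:C%C * circ s in
  u z' <= L ^+ n * u z /\ u z <= L ^+ n * u z'.
Proof.
move=> x1; have /andP[L1 _] := growth_rate_bounds.
elim: n X => [|n IH] X xX.
  rewrite !expr0 mul1r => Xx; have -> : X = x by apply/le_anti/andP.
  by move=> z z'; rewrite !mul1r.
move=> Xn z z'.
have z1 : cmod z < 1 by have /andP[? ?] := hrad_bounds x1; rewrite cmod_radial.
have X1 := le_trans x1 xX.
have z'1 : cmod z' < 1 by have /andP[? ?] := hrad_bounds X1; rewrite cmod_radial.
have uz := poisson_int_ge0 z1; have uz' := poisson_int_ge0 z'1.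
(* Within one doubling a single step suffices, as L >= 1; otherwise the induction reaches X / 2 and
   one more doubling reaches X. *)
have [X2|X2] := leP X (2 * x).
  have [h1 h2] := poisson_int_double s x1 xX X2; rewrite exprSr.
  have Ln : 1 <= L ^+ n by rewrite exprn_ege1.
  split; [apply: le_trans h1 _|apply: le_trans h2 _]; rewrite ler_wpM2r //;
  by rewrite ler_peMl //; lra.
have X21 : x <= X / 2 by rewrite ler_pdivlMr // mulrC ltW.
have X2n : X / 2 <= 2 ^+ n * x by rewrite ler_pdivrMr // mulrAC -exprSr.
have [h1 h2] := IH _ X21 X2n.
have [h3 h4] : u z' <= L * u ((hrad (X / 2))%:C%C * circ s) /\
    u ((hrad (X / 2))%:C%C * circ s) <= L * u z'.
  by apply: poisson_int_double; lra.
have Ln : 0 <= L ^+ n by rewrite exprn_ge0 //; lra.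
split.
  by apply: le_trans h3 _; rewrite exprS -mulrA ler_wpM2l //; lra.
by apply: le_trans h2 _; rewrite exprSr -mulrA ler_wpM2l.
Qed.

End Growth.

(** * Contractivity and arcs *)

Lemma exists_expr_ge (R : realType) (q M : R) : 1 < q -> exists n, M <= q ^+ n.
Proof.
move=> q1; have bern n : 1 + n%:R * (q - 1) <= q ^+ n.
  elim: n => [|n IH]; first by rewrite mul0r addr0 expr0.
  have qn : 1 <= q ^+ n by rewrite exprn_ege1 // ltW.
  rewrite exprS -natr1; nra.
have [n Mn] : exists n : nat, M / (q - 1) <= n%:R.
  exists (Num.truncn `|M / (q - 1)|).+1; apply: le_trans (ler_norm _) _.
  by apply/ltW; exact: truncnS_gt.
exists n; apply: le_trans (bern n); move: Mn; rewrite ler_pdivrMr; lra.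
Qed.

Section Arcs.
Variables (R : realType) (sigma : {measure set R -> \bar R}).
Hypothesis sigma_fin : (sigma setT < +oo)%E.
Implicit Types (z w v : R[i]) (a l r s t d : R).

Local Notation E g := (\int[sigma]_(t in `[0%R, 1%R[) g t).
Local Notation u := (poisson_int sigma).

Lemma cmod_z_arc a l : l <= 1 -> cmod (z_arc a l) = 1 - l.
Proof. by move=> l1; rewrite /z_arc cmod_radial // subr_ge0. Qed.

Lemma cmod_circB_rad r s : 0 <= r <= 1 -> cmod (circ s - r%:C%C * circ s) = 1 - r.
Proof.
move=> /andP[r0 r1]; rewrite -{1}[circ s]mul1r -[1]/(1%:C%C) -mulrBl -rmorphB.
by rewrite cmodM cmod_circ mulr1 cmodR ger0_norm // subr_ge0.
Qed.

(** The radial projection of a point is its nearest point on the circle, so projecting at most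
    doubles the distance to e. *)
Lemma cmod_circB_proj r s t : 0 <= r < 1 ->
  cmod (circ t - circ s) <= 2 * cmod (circ t - r%:C%C * circ s).
Proof.
move=> /andP[r0 r1]; apply: le_trans (cmodBD _ _ (r%:C%C * circ s)) _.
rewrite (cmodB (r%:C%C * circ s)) cmod_circB_rad ?r0 ?(ltW r1) //.
by have := cmod_circB_ge (r%:C%C * circ s) t; rewrite cmod_radial //; lra.
Qed.

(** The constant [2 * A ^+ 2] of [poisson_comp] for the distance ratio A = 50 obtained in
    [poisson_off_arc]. *)
Definition off_arc_const : R := 2 * 50 ^+ 2.
Local Notation K := off_arc_const.

Lemma off_arc_const_ge1 : 1 <= K.
Proof. by rewrite /off_arc_const -natrX -natrM ler1n. Qed.

(** From e outside I, a point above the middle half of I is no nearer, up to a constant factor, than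
    z_I; so the kernel is at most that of z_I times the ratio of the heights. *)
Lemma poisson_off_arc a l t d r : 0 < l <= 1 -> 0 <= t < 1 -> ~ circ_arc a l t ->
  `|d| <= l / 4 -> 0 <= r < 1 ->
  poisson (r%:C%C * circ (a + l / 2 + d)) t
    <= K * ((1 - r) / l) * poisson (z_arc a l) t.
Proof.
move=> /andP[l0 l1] t01 tI dl /andP[r0 r1].
have [d' [d'2 ld' te]] := circ_arc_notin t01 tI.
have r01 : 0 <= r < 1 by rewrite r0.
set c := a + l / 2; set z := _ * circ _.
have z1 : cmod z < 1 by rewrite cmod_radial.
have zI1 : cmod (z_arc a l) < 1 by rewrite cmod_z_arc //; lra.
(* The angular distance is more than l/2 - l/4 and at most 1/2 + 1/4, the range of [chord_ge34]. *)
have far : l / 8 <= cmod (circ t - circ (c + d)).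
  rewrite te -/c; have := @chord_ge34 R (c + d') (c + d).
  have -> : c + d' - (c + d) = d' - d by ring.
  have h1 : `|d'| <= `|d' - d| + `|d| by rewrite -{1}(subrK d d') ler_normD.
  have h2 := ler_normB d' d.
  move=> /(_ _) h; apply: le_trans (h _); lra.
(* With D = |e - z|, [far] and projection give l <= 16 D, and the path through both projections has
   length at most 2 D + 2 l + l <= 50 D. *)
have near : cmod (circ t - z_arc a l) <= 50 * cmod (circ t - z).
  have h1 := @cmod_circB_proj r (c + d) t r01; rewrite -/z in h1.
  have h2 := cmodBD (circ t) (z_arc a l) (circ (c + d)).
  have h3 := cmodBD (circ (c + d)) (z_arc a l) (circ c).
  have h4 := chord_le (c + d) c; rewrite (addrC c) addrK in h4.
  have h5 : cmod (circ c - z_arc a l) = l.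
    by rewrite /z_arc cmod_circB_rad; [ring|apply/andP; split; lra].
  by rewrite (addrC d) in h4; lra.
rewrite /off_arc_const [2 * _ * (_ / _)]mulrAC.
apply: poisson_comp => //; first by rewrite divr_ge0 ?subr_ge0 // ltW.
rewrite cmod_radial // cmod_z_arc // opprB addrCA subrr addr0 divfK //.
by rewrite gt_eqF.
Qed.

(** * From contractivity to the arc condition *)

Lemma contractive_arc_lower (k : R) : 0 <= k < 1 ->
  (forall z v, cmod z < 1 -> cmod v = 1 -> E (dpoisson z v) <= k * u z) ->
  exists2 c : R, 0 < c & forall a l, 0 < l <= 1 ->
    c * l * u (z_arc a l) <= fine (sigma (circ_arc a l)).
Proof.
move=> k01 hk; set L := growth_rate k.
have /andP[L1 L2] : 1 <= L < 2 by exact: growth_rate_bounds.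
have L0 : 0 < L by lra.
have K1 := off_arc_const_ge1; have K0 : 0 < K by exact: lt_le_trans K1.
(* After n doublings u has lost at most the factor L^n, while the part off the arc is at most 2 K /
   2^n times u(z_I). This n makes the latter at most half of what remains. *)
have [n hn] : exists n, 4 * K <= (2 / L) ^+ n.
  by apply: exists_expr_ge; rewrite ltr_pdivlMr // mul1r.
have Ln : 0 < L ^+ n by rewrite exprn_gt0.
rewrite expr_div_n ler_pdivlMr // in hn.
have n1 : 1 <= (2 : R) ^+ n by rewrite exprn_ege1 // ler1n.
have growth := poisson_int_growth sigma_fin k01 hk (n := n); rewrite -/L in growth.
move: (2 ^+ n) (L ^+ n) n1 hn Ln growth => N Q N1 hn Q0 growth {L1 L2 L0 k01 hk}.
have N0 : 0 < N by exact: lt_le_trans N1.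
exists (1 / (N * (4 * N))); first by rewrite divr_gt0 // !mulr_gt0.
move=> a l /andP[l0 l1]; have l01 : 0 < l <= 1 by rewrite l0.
(* [x] is the value of (1 + r) / (1 - r) at |z_I| = 1 - l, and [X] lies n doublings further out on
   the same radius. *)
pose x : R := (2 - l) / l; pose X : R := N * x.
have xl : x = 2 / l - 1 by rewrite /x mulrBl divff // gt_eqF.
have il : 1 <= 1 / l by rewrite ler_pdivlMr // mul1r.
have x1 : 1 <= x by lra.
have x0 : 0 <= x by lra.
have xX : x <= X by rewrite /X ler_peMl.
have X1 := le_trans x1 xX.
have /andP[X0 X2] := hrad_bounds X1.
have rx : hrad x = 1 - l.
  rewrite /hrad xl (_ : 2 / l - 1 + 1 = 2 / l); last by rewrite subrK.
  by field; rewrite gt_eqF.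
set c := a + l / 2.
have [_] := growth _ _ c x1 xX (lexx _).
rewrite rx -[_ * circ c]/(z_arc a l) => {growth}.
set zX := _ * circ c => hu.
have zX1 : cmod zX < 1 by rewrite cmod_radial.
have zI1 : cmod (z_arc a l) < 1 by rewrite cmod_z_arc // ltrBlDr ltrDl.
have uI := poisson_int_ge0 sigma zI1.
have rX := onem_hrad X1.
have X10 : 0 < X + 1 by apply: ltr_wpDl => //; apply: le_trans X1.
have NX : N / l <= X.
  rewrite /X ler_pM2l // xl; move: il; rewrite div1r; lra.
have hX : u zX <= 2 / (1 - cmod zX) * fine (sigma (circ_arc a l))
    + 2 * K / N * u (z_arc a l).
  apply: poisson_int_indic_comp => //.
  - exact: measurable_circ_arc.
  - exact: circ_arc_sub.
  - exact: bounded_measurable_poisson.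
  move=> t t01; rewrite indicE; have [tI|tI] := boolP (t \in circ_arc a l).
    rewrite mulr1; apply: le_trans (poisson_le t zX1) _; rewrite lerDl.
    apply: mulr_ge0; last by apply/ltW; exact: poisson_gt0.
    by apply: divr_ge0; [apply: mulr_ge0|]; rewrite ?(ltW N0) ?(ltW K0).
  rewrite mulr0 add0r.
  have := @poisson_off_arc a l t 0 (hrad X) l01 t01.
  rewrite addr0 normr0 => /(_ _ _ _)/le_trans; apply.
  - by move=> h; move/negP: tI; apply; rewrite inE.
  - by rewrite divr_ge0 // ltW.
  - by rewrite X0.
  rewrite ler_wpM2r ?(ltW (poisson_gt0 _ _)) // rX.
  rewrite [leRHS](_ : _ = K * (2 / N)); last by ring.
  rewrite ler_pM2l //.
  rewrite -mulrA ler_pM2l // -invfM lef_pV2 ?posrE ?mulr_gt0 //.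
  by move: NX; rewrite ler_pdivrMr //; have := mulr_gt0 X10 l0; lra.
have h2X : 2 / (1 - cmod zX) <= 4 * N / l.
  rewrite cmod_radial // rX invf_div mulrCA divff // mulr1.
  have : X <= N * (2 / l) by rewrite /X ler_pM2l // xl lerBlDr lerDl.
  have : 1 <= N / l by rewrite ler_pdivlMr // mul1r (le_trans l1).
  have -> : N * (2 / l) = 2 * (N / l) by ring.
  have -> : 4 * N / l = 4 * (N / l) by ring.
  move: (N / l) => q; clear; lra.
have S0 : 0 <= fine (sigma (circ_arc a l)) by rewrite fine_ge0.
(* The growth bound is twice the share of the complement in [hX], so the arc supplies the other
   half. *)
have h4 : 4 * K / N * u (z_arc a l) <= u zX.
  apply: le_trans (_ : Q^-1 * u (z_arc a l) <= _); last first.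
    by rewrite mulrC ler_pdivrMr // mulrC.
  by rewrite ler_wpM2r // ler_pdivrMr // [leRHS]mulrC ler_pdivlMr.
have h5 := ler_wpM2r S0 h2X.
have h3 : 2 * K / N * u (z_arc a l) <= 4 * N / l * fine (sigma (circ_arc a l)).
  move: h4 hX h5; rewrite -!(mulrA _ K).
  move: (2 / _ * _) (_ / l * _) (K / N) (u zX) (u _) => p q m y w; clear; lra.
have p0 : 0 < 4 * N / l by rewrite divr_gt0 // mulr_gt0.
rewrite -(ler_pM2l p0); apply: le_trans h3.
rewrite [leLHS](_ : _ = 1 / N * u (z_arc a l)); last by field; rewrite !gt_eqF.
by rewrite ler_wpM2r // ler_pM2r ?invr_gt0 // mulr_natl mulr2n (le_trans K1) // lerDl ltW.
Qed.

(** * From the arc condition to contractivity *)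

Lemma onem_Re_unimodular z : cmod z = 1 -> 1 - complex.Re z = cmod (z - 1) ^+ 2 / 2.
Proof.
move=> z1; have : cmod z ^+ 2 = 1 by rewrite z1 expr1n.
by rewrite !sqr_cmod; case: {z1} z => x y /=; lra.
Qed.

(** For each v, the number v w stays away from 1 on at least one of two separated arcs near z/|z|.
    That arc carries a fixed share of u(z), and there Re (v w) has a fixed deficit from 1. *)
Lemma arc_lower_contractive c : 0 < c ->
  (forall a l, 0 < l <= 1 -> c * l * u (z_arc a l) <= fine (sigma (circ_arc a l))) ->
  exists2 kappa : R, 0 < kappa & forall z v, cmod z < 1 -> cmod v = 1 ->
    E (dpoisson z v) <= (1 - kappa) * u z.
Proof.
move=> c0 hc.
(* Half of the separation 1/288 = (d * d / 8) / (6 d)^2 found in [sep]. *)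
have [e e0 eE] : exists2 e : R, 0 < e & e = 1 / 576.
  exists (1 / 576); last reflexivity.
  by rewrite divr_gt0 ?ltr01 ?ltr0n.
have e20 : 0 < e ^+ 2 by rewrite exprn_gt0.
(* Product of the deficit e^2 / 2 of the real part, the lower bound 1 / (36 d) of the kernel on the
   arc, and the mass c / 4 / 392 * d of the arc relative to u(z). *)
exists (e ^+ 2 / 2 / 36 * (c / 4) / 392).
  by rewrite divr_gt0 ?ltr0n // mulr_gt0 // !divr_gt0 ?ltr0n.
move=> z v z1 v1; have [s zE] := polar z; set r := cmod z in zE *.
have r0 : 0 <= r by exact: cmod_ge0.
set d := 1 - r; have d0 : 0 < d by rewrite subr_gt0.
have d1 : d <= 1 by rewrite /d; lra.
have sz : cmod (circ s - z) = d by rewrite zE cmod_circB_rad // r0 ltW.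
(* The arc of length d/4 centred at s + b. Only b = 0 and b = d/2 are used, and these two arcs are
   d/4 apart. *)
pose J b := circ_arc (s + b - d / 8) (d / 4).
have Jn b t : 0 <= b <= d / 2 -> J b t -> cmod (circ t - z) <= 6 * d.
  move=> /andP[b0 b1] /circ_arc_in[y [yl ->]].
  have h1 := cmodBD (circ (s + b - d / 8 + d / 4 / 2 + y)) z (circ s).
  have h2 := chord_le (s + b - d / 8 + d / 4 / 2 + y) s.
  have : `|s + b - d / 8 + d / 4 / 2 + y - s| <= 5 / 8 * d.
    by move: yl; rewrite !ler_norml => /andP[? ?]; apply/andP; split; lra.
  lra.
have uz := poisson_int_ge0 sigma z1.
have P0 t := poisson_gt0 t z1.
have Jlow b : 0 <= b <= d / 2 -> c / 4 / 392 * d * u z <= fine (sigma (J b)).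
  move=> /andP[b0 b1]; apply: le_trans (hc _ _ _); last by apply/andP; split; lra.
  have zJ1 : cmod (z_arc (s + b - d / 8) (d / 4)) < 1 by rewrite cmod_z_arc; lra.
  (* Harnack with |z - z_J| <= d + 8 b + d/4 <= 6 d and with heights in the ratio 4; the constant is
     392. *)
  have h : u z <= 2 * 4 * (1 + 6) ^+ 2 * u (z_arc (s + b - d / 8) (d / 4)).
    apply: poisson_int_harnack => //; rewrite ?cmod_z_arc -/r -/d; try lra.
    apply: le_trans (cmodBD _ _ (circ s)) _; rewrite (cmodB z) sz.
    apply: le_trans (lerD (lexx _) (cmodBD _ _ (circ (s + b)))) _.
    have h1 := chord_le s (s + b); rewrite opprD addNKr normrN ger0_norm // in h1.
    have -> : cmod (circ (s + b) - z_arc (s + b - d / 8) (d / 4)) = d / 4.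
      rewrite /z_arc (_ : s + b - d / 8 + d / 4 / 2 = s + b); last by lra.
      by rewrite cmod_circB_rad; [ring|apply/andP; split; lra].
    lra.
  have := ler_wpM2l (ltW (mulr_gt0 c0 d0)) h; lra.
have sep t1 t2 : J 0 t1 -> J (d / 2) t2 ->
    2 * e <= cmod (v * cayley z t1 - 1) + cmod (v * cayley z t2 - 1).
  move=> j1 j2.
  apply: le_trans (_ : cmod (cayley z t1 - cayley z t2) <= _); last first.
    rewrite (cmodB _ 1 : cmod (v * cayley z t2 - 1) = _).
    rewrite -[leLHS]mul1r -v1 -cmodM mulrBr; exact: cmodBD.
  rewrite cayleyB // ler_pdivlMr ?mulr_gt0 ?cmod_circB_gt0 //.
  have n1 := Jn _ _ _ j1; have n2 := Jn _ _ _ j2.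
  have {}n1 : cmod (circ t1 - z) <= 6 * d by apply: n1; apply/andP; split; lra.
  have {}n2 : cmod (circ t2 - z) <= 6 * d by apply: n2; apply/andP; split; lra.
  have /andP[h1 _] := onemsqr_cmod_bounds z1.
  have h2 : d / 8 <= cmod (circ t1 - circ t2).
    have [y1 [yl1 ->]] := circ_arc_in j1; have [y2 [yl2 ->]] := circ_arc_in j2.
    rewrite cmodB; set p := _ + y1; set q := _ + y2.
    have pq : d / 4 <= q - p <= 3 / 4 * d.
      by move: yl1 yl2; rewrite /p /q !ler_norml => /andP[? ?] /andP[? ?]; apply/andP;
        split; lra.
    have := @chord_ge34 R q p; rewrite ger0_norm; last by lra.
    by move=> /(_ _) h; apply: le_trans (h _); lra.
  have h3 : cmod (circ t1 - z) * cmod (circ t2 - z) <= 6 * d * (6 * d).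
    by apply: ler_pM => //; exact: cmod_ge0.
  have h4 : d * (d / 8) <= (1 - cmod z ^+ 2) * cmod (circ t1 - circ t2).
    by apply: ler_pM => //; rewrite ?divr_ge0 // ltW.
  rewrite eE; lra.
(* If some point of the first arc brings v w within e of 1, then [sep] keeps the whole second arc at
   distance e from 1. *)
have [b b01 hb] : exists2 b, 0 <= b <= d / 2 & forall t, J b t -> e <= cmod (v * cayley z t
  - 1).
  have [h|/existsNP[t1 /not_implyP[j1 /negP]]] :=
    pselect (forall t, J 0 t -> e <= cmod (v * cayley z t - 1)).
    by exists 0 => //; apply/andP; split; lra.
  rewrite -ltNge => h1; exists (d / 2); first by apply/andP; split; lra.
  by move=> t2 j2; have := sep _ _ j1 j2; lra.
have mJ : measurable (J b) by exact: measurable_circ_arc.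
have := @poisson_int_indic_comp _ sigma sigma_fin (J b) (dpoisson z v) z
  (- (e ^+ 2 / 2 / 36 / d)) 1 mJ (@circ_arc_sub _ _ _)
  (bounded_measurable_dpoisson v z1) z1.
move=> /(_ _)/le_trans; apply.
  move=> t t01; have vc1 : cmod (v * cayley z t) = 1 by rewrite cmodM v1 cmod_cayley // mulr1.
  rewrite mul1r indicE /dpoisson.
  have h0 : 0 <= 1 - complex.Re (v * cayley z t).
    by rewrite subr_ge0 -vc1 Re_le_cmod.
  have [tJ|tJ] := boolP (t \in J b); last first.
    by rewrite mulr0 add0r ler_piMl ?(ltW (P0 t)) // -vc1 Re_le_cmod.
  rewrite inE in tJ.
  have h1 : e ^+ 2 / 2 <= 1 - complex.Re (v * cayley z t).
    rewrite (onem_Re_unimodular vc1) ler_pM2r // lerXn2r ?nnegrE ?cmod_ge0 ?hb //.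
    exact: ltW.
  have h2 := poisson_ge z1 (Jn _ _ b01 tJ).
  have h3 : e ^+ 2 / 2 * ((1 - cmod z) / (6 * d) ^+ 2) <= (1 - complex.Re (v * cayley z t))
    * poisson z t.
    apply: ler_pM => //; first by rewrite divr_ge0 // ltW.
    by rewrite divr_ge0 ?exprn_ge0 ?mulr_ge0 // ltW.
  have : e ^+ 2 / 2 * ((1 - cmod z) / (6 * d) ^+ 2) = e ^+ 2 / 2 / 36 / d.
    by rewrite -/r -/d; field; rewrite gt_eqF.
  rewrite mulr1; lra.
have := Jlow b b01.
have q0 : 0 < e ^+ 2 / 2 / 36 / d by rewrite !divr_gt0 ?ltr0n.
rewrite -(ler_pM2l q0).
rewrite [X in X <= _](_ : _ = e ^+ 2 / 2 / 36 * (c / 4) / 392 * u z); last first.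
  by field; rewrite gt_eqF.
lra.
Qed.

End Arcs.

(** * Carleson boxes and squares *)

Section Nonneg.
Local Open Scope ereal_scope.
Context d (T : measurableType d) (R : realType) (mu : {measure set T -> \bar R}).

Import HBNNSimple.

(* no measurability is needed: the integral of a nonnegative function is a
   supremum over the simple functions below it *)
Lemma ge0_le_integral_any (f g : T -> \bar R) :
  (forall x, 0 <= f x) -> (forall x, f x <= g x) -> \int[mu]_x f x <= \int[mu]_x g x.
Proof.
move=> f0 fg; have g0 x : 0 <= g x by exact: le_trans (fg x).
rewrite !ge0_integralTE //; apply: ereal_sup_le => _ [h hf <-].
by exists h => // x; exact: le_trans (hf x) (fg x).
Qed.

Lemma integral_cst_indic (A : set T) (c : R) : measurable A -> (0 <= c)%R ->
  \int[mu]_x (c * \1_A x)%:E = c%:E * mu A.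
Proof.
move=> mA c0; under eq_integral do rewrite EFinM.
rewrite ge0_integralZl_EFin //.
- by rewrite integral_indic // setIT.
- by apply/measurable_EFinP; exact: measurable_indic.
Qed.

End Nonneg.

Section Box.
Variable R : realType.
Implicit Types (z : R[i]) (a l s t d y : R) (p : R * R).

Local Notation lambda2 := (@lebesgue_measure R \x @lebesgue_measure R)%E.
Local Notation cplx p := (p.1 +i* p.2)%C.

Lemma carleson_boxP a l p : carleson_box a l p ->
  exists d, [/\ `|d| <= l / 2, 0 < cmod (cplx p) < 1, 1 - cmod (cplx p) <= l &
    cplx p = (cmod (cplx p))%:C%C * circ (a + l / 2 + d)].
Proof.
move=> [/andP[z0 z1] [zl [t [/circ_arc_in[d [dl td]] zt]]]]; exists d; split=> //.
  by rewrite z0.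
rewrite -td -zt mulrC divfK //.
by rewrite -[0]/(0%:C%C) (inj_eq (@complexI R)) gt_eqF.
Qed.

Lemma carleson_boxI a l d p : 0 < cmod (cplx p) < 1 -> 1 - cmod (cplx p) <= l ->
  `|d| <= l / 2 -> cplx p = (cmod (cplx p))%:C%C * circ (a + l / 2 + d) ->
  carleson_box a l p.
Proof.
move=> /andP[z0 z1] zl; rewrite ler_norml => /andP[dl1 dl2] zE.
split; first by rewrite /= z0.
split=> //; set t := a + l / 2 + d in zE.
exists (t + (- Num.floor t)%:~R); split.
  have /andP[h1 h2] := floor_itv t; split.
    rewrite mulrNz; move: h2; rewrite intrD => h2; apply/andP; split; lra.
  exists (Num.floor t); rewrite mulrNz subrK /t; apply/andP; split; lra.
rewrite circD_int {1}zE mulrAC divff ?mul1r //.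
by rewrite -[0]/(0%:C%C) (inj_eq (@complexI R)) gt_eqF.
Qed.

Lemma ler_cos_pi (x y : R) : 0 <= x <= pi -> 0 <= y <= pi -> (cos x <= cos y) = (y <= x).
Proof.
by move=> x0 y0; rewrite !leNgt ltr_cos.
Qed.

(** The angular condition |d| <= l/2 becomes a bound on the inner product with the central
    direction, since cos decreases on [0, pi]. This form has no quantifier and shows that the box is
    measurable. *)
Lemma carleson_box_cone a l p : 0 < l <= 1 -> carleson_box a l p <->
  [/\ 0 < cmod (cplx p) < 1, 1 - cmod (cplx p) <= l &
    cmod (cplx p) * cos (pi * l) <=
      p.1 * cos (2 * pi * (a + l / 2)) + p.2 * sin (2 * pi * (a + l / 2))].
Proof.
move=> /andP[l0 l1]; set c := a + l / 2; have pi0 := pi_gt0 R.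
have dot d : cplx p = (cmod (cplx p))%:C%C * circ (c + d) ->
    p.1 * cos (2 * pi * c) + p.2 * sin (2 * pi * c) = cmod (cplx p) * cos (2 * pi * `|d|).
  rewrite -[2 * pi]gtr0_norm ?mulr_gt0 // -normrM cos_norm gtr0_norm ?mulr_gt0 //.
  have -> : 2 * pi * d = 2 * pi * (c + d) - 2 * pi * c by ring.
  rewrite cosB; move: (cmod _) => m /eqP; rewrite eq_complex /= !mul0r subr0 addr0.
  by move=> /andP[/eqP -> /eqP ->]; ring.
have pil : 0 <= pi * l <= pi.
  by rewrite mulr_ge0 ?(ltW l0) ?(ltW pi0) // ler_piMr // ltW.
split.
  move=> /carleson_boxP[d [dl z01 zl zE]]; split=> //.
  rewrite (dot _ zE) ler_pM2l; last by case/andP: z01.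
  have d0 := normr_ge0 d.
  have dpi : 2 * pi * `|d| <= pi * l by nra.
  rewrite ler_cos_pi //; apply/andP; split; first by rewrite !mulr_ge0 // ltW.
  by case/andP: pil => _; exact: le_trans.
move=> [z01 zl]; have [d [d2 zE]] := polar_near (cplx p) c.
rewrite (dot _ zE) ler_pM2l; last by case/andP: z01.
have d0 := normr_ge0 d.
rewrite ler_cos_pi //; last first.
  by apply/andP; split; [rewrite !mulr_ge0 // ltW|nra].
move=> dl; apply: (@carleson_boxI a l d) => //.
move: dl; rewrite mulrAC [leLHS]mulrC ler_pM2l //; lra.
Qed.

Lemma measurable_cmod : measurable_fun setT (fun p => cmod (cplx p)).
Proof.
apply: measurableT_comp.
  by apply: continuous_measurable_fun; exact: sqrt_continuous.
apply: measurable_funD; apply: measurable_funX; [exact: measurable_fst|exact: measurable_snd].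
Qed.

Lemma measurable_carleson_box a l : 0 < l <= 1 -> measurable (carleson_box a l).
Proof.
move=> l01; have mc := measurable_cmod.
rewrite (_ : carleson_box a l =
  [set p | 0 < cmod (cplx p)] `&` [set p | cmod (cplx p) < 1]
  `&` [set p | 1 - cmod (cplx p) <= l] `&`
  [set p | cmod (cplx p) * cos (pi * l) <=
    p.1 * cos (2 * pi * (a + l / 2)) + p.2 * sin (2 * pi * (a + l / 2))]); last first.
  apply/seteqP; split => p.
    by move/(carleson_box_cone _ _ l01) => [/andP[? ?] ? ?].
  by move=> [[[? ?] ?] ?]; apply/(carleson_box_cone _ _ l01); split=> //; apply/andP.
have mlt (f g : R * R -> R) : measurable_fun setT f -> measurable_fun setT g ->
    measurable [set p | f p < g p].
  move=> mf mg; have := measurable_funB mg mf measurableT (measurable_itv `]0, +oo[).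
  by rewrite setTI; congr measurable; apply/seteqP; split=> p /=;
    rewrite in_itv /= andbT subr_gt0.
have mle (f g : R * R -> R) : measurable_fun setT f -> measurable_fun setT g ->
    measurable [set p | f p <= g p].
  move=> mf mg; have := measurable_funB mg mf measurableT (measurable_itv `[0, +oo[).
  by rewrite setTI; congr measurable; apply/seteqP; split=> p /=;
    rewrite in_itv /= andbT subr_ge0.
apply: measurableI; first apply: measurableI; first apply: measurableI.
- exact: mlt.
- exact: mlt.
- by apply: mle => //; exact: measurable_funB.
- apply: mle; first exact: measurable_funM.
  by apply: measurable_funD; apply: measurable_funM.
Qed.

(** Used instead of discs: it contains the disc of radius h, lies in that of radius 2 h, and has an
    explicit product measure. *)
Definition square z (h : R) : set (R * R) :=
  `[complex.Re z - h, complex.Re z + h] `*` `[complex.Im z - h, complex.Im z + h].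

Lemma measurable_square z (h : R) : measurable (square z h).
Proof. by apply: measurableX; exact: measurable_itv. Qed.

Lemma lambda2_square z (h : R) : 0 < h -> lambda2 (square z h) = ((2 * h) ^+ 2)%:E.
Proof.
move=> h0.
transitivity (lebesgue_measure (`[(complex.Re z - h)%R, (complex.Re z + h)%R]%classic : set
  R) *
  lebesgue_measure (`[(complex.Im z - h)%R, (complex.Im z + h)%R]%classic : set R))%E.
  by apply: product_measure1E; exact: measurable_itv.
rewrite !lebesgue_measure_itv /= !lte_fin !ifT; [|lra|lra].
by rewrite -!EFinB -EFinM; congr EFin; ring.
Qed.

Lemma square_cmod z (h : R) p : square z h p -> cmod (cplx p - z) <= 2 * h.
Proof.
move=> [/=]; rewrite !in_itv /= => /andP[h1 h2] /andP[h3 h4].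
apply: le_trans (cmod_le_ReIm _) _; case: z h1 h2 h3 h4 => x y /= h1 h2 h3 h4.
have : `|p.1 - x| <= h by rewrite ler_norml; apply/andP; split; lra.
have : `|p.2 - y| <= h by rewrite ler_norml; apply/andP; split; lra.
lra.
Qed.

Lemma cmod_square z (h : R) p : cmod (cplx p - z) <= h -> square z h p.
Proof.
move=> hz; have := normRe_le_cmod (cplx p - z); have := normIm_le_cmod (cplx p - z).
case: z hz => x y /= hz /le_trans/(_ hz) + /le_trans/(_ hz).
rewrite !ler_norml => /andP[h1 h2] /andP[h3 h4].
by split; rewrite /= in_itv /=; apply/andP; split; lra.
Qed.

Lemma inscribed_square a l d y p : 0 < y <= 1 / 2 -> 5 / 4 * y <= l ->
  `|d| + y / 2 <= l / 2 ->
  square ((1 - y)%:C%C * circ (a + l / 2 + d)) (y / 8) p ->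
  [/\ carleson_box a l p,
      cmod (cplx p - (1 - y)%:C%C * circ (a + l / 2 + d)) <= y / 4 &
      3 / 4 * y <= 1 - cmod (cplx p) <= 5 / 4 * y].
Proof.
move=> /andP[y0 y2] yl dl /square_cmod.
set z0 := _ * circ _; rewrite (_ : 2 * (y / 8) = y / 4); last by lra.
set z := cplx p => zz; have z0E : cmod z0 = 1 - y by rewrite cmod_radial; lra.
have h1 := cmod_subl z z0; have h2 := cmod_subl z0 z; rewrite (cmodB z0) in h2.
rewrite z0E in h1 h2.
have [d' [d'2 zE]] := polar_near z (a + l / 2 + d).
split=> //; last by apply/andP; split; lra.
(* The radial and total displacements are at most y/4 each, so the chord times 1 - y >= 1/2 is at
   most y/2; then [chord_ge] applies. *)
have d'y : `|d'| <= y / 2.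
  have := @chord_ge R (a + l / 2 + d + d') (a + l / 2 + d).
  rewrite (addrC _ d') addrK => /(_ d'2); rewrite (addrC d').
  set e' := circ _; set e := circ _ => hch.
  have : (1 - y) * cmod (e' - e) <= y / 2.
    have <- : cmod ((1 - y)%:C%C * e' - z0) = (1 - y) * cmod (e' - e).
      by rewrite /z0 -mulrBr cmodM cmodR ger0_norm; lra.
    apply: le_trans (cmodBD _ _ z) _.
    have -> : cmod ((1 - y)%:C%C * e' - z) = `|1 - y - cmod z|.
      by rewrite {1}zE -mulrBl cmodM cmod_circ mulr1 -rmorphB cmodR.
    have : `|1 - y - cmod z| <= y / 4 by rewrite ler_norml; apply/andP; split; lra.
    lra.
  have := cmod_ge0 (e' - e); nra.
apply: (@carleson_boxI a l (d + d')) => //.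
- by apply/andP; split; rewrite -/z; lra.
- by rewrite -/z; lra.
- by apply: le_trans (ler_normD _ _) _; lra.
- by rewrite [in RHS]addrA.
Qed.

Lemma lambda2_box_ge a l : 0 < l <= 1 ->
  (((l / 8) ^+ 2)%:E <= lambda2 (carleson_box a l))%E.
Proof.
move=> /andP[l0 l1].
have -> : l / 8 = 2 * (l / 2 / 8) by lra.
rewrite -(lambda2_square ((1 - l / 2)%:C%C * circ (a + l / 2 + 0))); last by lra.
apply: le_measure; rewrite ?inE; try exact: measurable_square.
  by apply: measurable_carleson_box; rewrite l0.
move=> p hp; have [|||//] := inscribed_square _ _ _ hp; rewrite ?normr0; lra.
Qed.

(** Rounding the angle down to a multiple of s moves the boundary point by at most 8 s, and the
    height adds at most s. *)
Lemma covering_square a l s p : 0 < l <= 1 -> 0 < s -> carleson_box a l p ->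
  1 - cmod (cplx p) <= s ->
  exists j : nat, j%:R * s <= l /\
    square (circ (a + l / 2 + (j%:R * s - l / 2))) (9 * s) p.
Proof.
move=> /andP[l0 l1] s0 /carleson_boxP[d [dl /andP[z0 z1] zl zE]] zs.
move: dl; rewrite ler_norml => /andP[dl1 dl2].
have q0 : 0 <= (d + l / 2) / s by rewrite divr_ge0 ?(ltW s0) //; lra.
exists (Num.truncn ((d + l / 2) / s)).
have /andP[] := truncn_itv q0; rewrite ler_pdivlMr // ltr_pdivrMr //.
move: (Num.truncn _) => n; rewrite -(natr1 n); move: n%:R => j j1 j2; split; first lra.
apply: cmod_square; apply: le_trans (cmodBD _ _ (circ (a + l / 2 + d))) _.
rewrite {1}zE cmodB cmod_circB_rad; last by rewrite cmod_ge0 ltW.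
have := chord_le (a + l / 2 + d) (a + l / 2 + (j * s - l / 2)).
have : `|a + l / 2 + d - (a + l / 2 + (j * s - l / 2))| <= s.
  by rewrite ler_norml; apply/andP; split; lra.
lra.
Qed.

End Box.

(** * Contractivity implies the B2 condition *)

Section BoxIntegral.
Variable R : realType.
Implicit Types (z : R[i]) (a l s t d y h : R) (p : R * R).

Local Notation lambda2 := (@lebesgue_measure R \x @lebesgue_measure R)%E.
Local Notation cplx p := (p.1 +i* p.2)%C.

Lemma dyadic_scale h l : 0 < h <= l ->
  exists m, l / 2 ^+ m.+1 <= h <= l / 2 ^+ m.
Proof.
move=> /andP[h0 hl].
have ex : exists n, l / 2 ^+ n <= h.
  have [n hn] := @exists_expr_ge R 2 (l / h) (ltr1n R 2).
  by exists n; rewrite ler_pdivrMr ?exprn_gt0 // mulrC -ler_pdivrMr.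
case: (ex_minnP ex) => -[|n] hn nmin.
  exists 0; rewrite expr0 divr1 hl andbT; apply: le_trans hn.
  by rewrite expr0 divr1 expr1 ler_pdivrMr // ler_peMr ?ler1n // (le_trans (ltW h0)).
exists n; rewrite hn /=; apply/ltW; rewrite ltNge; apply/negP => /nmin.
by rewrite ltnn.
Qed.

Lemma geometric_sum_le (q C : R) n : 0 <= q < 1 -> 0 <= C ->
  \sum_(0 <= m < n) C * q ^+ m <= C / (1 - q).
Proof.
move=> /andP[q0 q1] C0; have q10 : 0 < 1 - q by rewrite subr_gt0.
rewrite -mulr_sumr ler_wpM2l // -[leRHS]mul1r ler_pdivlMr //.
have -> : (\sum_(0 <= m < n) q ^+ m) * (1 - q) = 1 - q ^+ n.
  elim: n => [|n IH]; first by rewrite big_nil mul0r expr0 subrr.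
  by rewrite big_nat_recr //= mulrDl IH exprS; ring.
by rewrite lerBlDr lerDl exprn_ge0.
Qed.

(** At height l / 2^m the box is covered by 2^m + 1 <= 2 * 2^m squares of side 18 l / 2^m, of total
    area at most [cover_const] l^2 / 2^m. *)
Definition cover_const : R := 2 * 18 ^+ 2.

Lemma cover_const_ge0 : 0 <= cover_const.
Proof. by rewrite /cover_const -natrX -natrM ler0n. Qed.

(** The function is dominated by a series of multiples of indicators of the covering squares, one
    group per dyadic height. Group m contributes O((L/2)^m), a geometric series because L < 2. *)
Lemma box_integral_le (g : R[i] -> R) (G L : R) a l :
  0 < l <= 1 -> 1 <= L < 2 -> 0 <= G ->
  (forall p, carleson_box a l p -> 0 <= g (cplx p)) ->
  (forall m p, carleson_box a l p ->
     l / 2 ^+ m.+1 <= 1 - cmod (cplx p) -> g (cplx p) <= G * L ^+ m) ->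
  (\int[lambda2]_(p in carleson_box a l) (g (cplx p))%:E
    <= (cover_const * l ^+ 2 * G / (1 - L / 2))%:E)%E.
Proof.
move=> l01 /andP[L1 L2] G0 g0 hg; have /andP[l0 l1] := l01.
have L0 : 0 <= L by lra.
pose s m : R := l / 2 ^+ m.
have s0 m : 0 < s m by rewrite divr_gt0 ?exprn_gt0.
pose S m (j : nat) := square (circ (a + l / 2 + (j%:R * s m - l / 2))) (9 * s m).
have mS m j : measurable (S m j) by exact: measurable_square.
have c0 m : 0 <= G * L ^+ m by rewrite mulr_ge0 // exprn_ge0.
pose F m p : \bar R := (\sum_(0 <= j < (2 ^ m).+1) (G * L ^+ m * \1_(S m j) p)%:E)%E.
have F0 m p : (0 <= F m p)%E by apply: sume_ge0 => j _; rewrite lee_fin mulr_ge0.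
have mind m j : measurable_fun setT (fun p => (G * L ^+ m * \1_(S m j) p)%:E).
  by apply/measurable_EFinP; apply: measurable_funM => //; exact: measurable_indic.
have mF m : measurable_fun setT (F m) by apply: emeasurable_sum => j; exact: mind.
rewrite integral_mkcond.
apply: (@le_trans _ _ (\int[lambda2]_p (\sum_(m <oo) F m p))%E).
  apply: ge0_le_integral_any => p.
    by rewrite patchE; case: ifPn => // /set_mem /g0; rewrite lee_fin.
  rewrite patchE; case: ifPn => [/set_mem pQ|_]; last exact: nneseries_ge0.
  have [_ [_ /andP[_ z1] zl _]] := carleson_boxP pQ.
  have [m /andP[m1 m2]] : exists m, l / 2 ^+ m.+1 <= 1 - cmod (cplx p) <= l / 2 ^+ m.
    by apply: dyadic_scale; rewrite subr_gt0 z1.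
  apply: le_trans (nneseries_lim_ge m.+1 _); last by [].
  rewrite big_nat_recr //=; apply: (@le_trans _ _ (F m p)); last first.
    by rewrite leeDr // sume_ge0.
  have [j [jl jS]] := covering_square l01 (s0 m) pQ m2.
  have jm : (j < (2 ^ m).+1)%N.
    rewrite ltnS -(ler_nat R) natrX.
    by move: jl; rewrite /s mulrCA ger_pMr // ler_pdivrMr ?exprn_gt0 // mul1r.
  rewrite /F (big_rem j) /=; last by rewrite mem_index_iota.
  apply: (@le_trans _ _ (G * L ^+ m * \1_(S m j) p)%:E).
    by rewrite indicE mem_set // mulr1 lee_fin; exact: hg.
  by rewrite leeDl // sume_ge0 // => i _; rewrite lee_fin mulr_ge0.
rewrite (@integral_nneseries _ _ _ lambda2 setT measurableT F mF (fun m p _ => F0 m p)).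
have intF m : (\int[lambda2]_p F m p = ((G * L ^+ m * (18 * s m) ^+ 2) *+ (2 ^ m).+1)%:E)%E.
  have ind0 j p : setT p -> (0 <= (G * L ^+ m * \1_(S m j) p)%:E)%E.
    by move=> _; rewrite lee_fin mulr_ge0.
  rewrite /F (@ge0_integral_sum _ _ _ lambda2 setT measurableT _ _ (mind m) ind0).
  transitivity (\sum_(0 <= j < (2 ^ m).+1) (G * L ^+ m * (18 * s m) ^+ 2)%:E)%E.
    apply: eq_bigr => j _; apply: (etrans (@integral_cst_indic _ _ _ lambda2 (S m j) _ (mS m
      j) (c0 m))).
    rewrite [RHS]EFinM; congr (_ * _)%E; rewrite (_ : 18 * s m = 2 * (9 * s m)); last by ring.
    by apply: lambda2_square; rewrite mulr_gt0.
  by rewrite sumEFin sumr_const_nat subn0.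
have q01 : 0 <= L / 2 < 1 by apply/andP; split; lra.
have C0 : 0 <= cover_const * l ^+ 2 * G.
  by rewrite !mulr_ge0 ?cover_const_ge0 // ltW.
apply: lime_le.
  by apply: is_cvg_nneseries => m _ _; rewrite integral_ge0.
near=> n; apply: (@le_trans _ _ (\sum_(0 <= m < n) (cover_const * l ^+ 2 * G * (L / 2) ^+
  m)%:E)%E).
  apply: lee_sum => m _; rewrite intF lee_fin.
  rewrite -[_ *+ (2 ^ m).+1]mulr_natr -(natr1 (2 ^ m)) natrX /s /cover_const.
  have e0 : 0 < (2 : R) ^+ m by rewrite exprn_gt0.
  have e1 : 1 <= (2 : R) ^+ m by rewrite exprn_ege1 // ler1n.
  have Lm : 0 <= L ^+ m by rewrite exprn_ge0.
  rewrite expr_div_n; move: (2 ^+ m) (L ^+ m) e0 e1 Lm => e M e0 e1 M0.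
  rewrite (_ : 2 * 18 ^+ 2 * l ^+ 2 * G * (M / e) = G * M * (18 * (l / e)) ^+ 2 * (2 * e));
    last first.
    by field; rewrite gt_eqF.
  by apply: ler_wpM2l; [apply: mulr_ge0; [exact: mulr_ge0|exact: sqr_ge0]|lra].
by rewrite sumEFin lee_fin; exact: geometric_sum_le.
Unshelve. all: by end_near.
Qed.

Lemma lambda2_box_fin a l : 0 < l <= 1 ->
  exists2 q : R, lambda2 (carleson_box a l) = q%:E &
    (l / 8) ^+ 2 <= q <= cover_const * l ^+ 2 * 2.
Proof.
move=> l01; have h1 := lambda2_box_ge a l01.
have mQ := measurable_carleson_box a l01.
have h2 : (lambda2 (carleson_box a l) <= (cover_const * l ^+ 2 * 2)%:E)%E.
  (* The area is the integral of the constant 1, bounded with growth rate L = 1. *)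
  have := @box_integral_le (fun=> 1) 1 1 a l l01.
  rewrite integral_cst // mul1e => /(_ _ _ _ _) /le_trans; apply => //.
  - by rewrite lexx ltr1n.
  - by move=> m p _ _; rewrite expr1n mulr1.
  - rewrite lee_fin (_ : 1 - 1 / 2 = 2^-1); last by lra.
    by rewrite mulr1 invrK.
move: h1 h2; case: (lambda2 _) => // q h1 h2; exists q => //.
by rewrite -!lee_fin h1.
Qed.

Lemma box_avgE (g : R[i] -> R) a l q : 0 < q ->
  lambda2 (carleson_box a l) = q%:E ->
  box_avg g (carleson_box a l) =
  ((q^-1)%:E * \int[lambda2]_(p in carleson_box a l) (g (cplx p))%:E)%E.
Proof.
move=> q0 hq; have pi0 := pi_gt0 R.
rewrite /box_avg /areaA hq -EFinM inver gt_eqF ?mulr_gt0 ?invr_gt0 //.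
rewrite muleA -EFinM; congr ((_)%:E * _)%E.
by rewrite invfM invrK mulrAC mulfV ?mul1r // gt_eqF.
Qed.

End BoxIntegral.

Section ContractiveB2.
Variables (R : realType) (sigma : {measure set R -> \bar R}).
Hypothesis sigma_fin : (sigma setT < +oo)%E.
Implicit Types (z w v : R[i]) (a l r s t d : R).

Local Notation E g := (\int[sigma]_(t in `[0%R, 1%R[) g t).
Local Notation u := (poisson_int sigma).
Local Notation cplx p := (p.1 +i* p.2)%C.

Hypothesis u_gt0 : forall z, cmod z < 1 -> 0 < u z.

(** First move at height l from z_I to the radius of the point, by Harnack with constant 50 = 2 * 1
    * (1 + 4)^2; then go along that radius in at most m + 2 doublings. *)
Lemma contractive_box_bounds (k : R) : 0 <= k < 1 ->
  (forall z v, cmod z < 1 -> cmod v = 1 -> E (dpoisson z v) <= k * u z) ->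
  let L := growth_rate k in forall a l m p, 0 < l <= 1 -> carleson_box a l p ->
    l / 2 ^+ m.+1 <= 1 - cmod (cplx p) ->
  u (cplx p) <= 50 * u (z_arc a l) * L ^+ m.+2 /\
  u (z_arc a l) <= 50 * L ^+ m.+2 * u (cplx p).
Proof.
move=> k01 hk L a l m p /andP[l0 l1] pQ hm.
have [d [dl /andP[z0 z1] zl zE]] := carleson_boxP pQ.
set z := cplx p in z0 z1 zl zE hm *; set e := circ _ in zE.
set w : R[i] := (1 - l)%:C%C * e.
have w1 : cmod w < 1 by rewrite cmod_radial; lra.
have wE : cmod w = 1 - l by rewrite cmod_radial; lra.
have zI1 : cmod (z_arc a l) < 1 by rewrite cmod_z_arc //; lra.
have zIE := cmod_z_arc a l1.
have wI : cmod (w - z_arc a l) <= 4 * l.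
  rewrite /w /z_arc -mulrBr cmodM cmodR ger0_norm ?subr_ge0 //.
  have := chord_le (a + l / 2 + d) (a + l / 2); rewrite (addrC _ d) addrK => h.
  rewrite /e (addrC _ d); have := cmod_ge0 (circ (d + (a + l / 2)) - circ (a + l / 2)); nra.
have H1 : u w <= 50 * u (z_arc a l).
  have -> : 50 = 2 * 1 * (1 + 4) ^+ 2 :> R by ring.
  by apply: poisson_int_harnack => //; lra.
have H2 : u (z_arc a l) <= 50 * u w.
  have -> : 50 = 2 * 1 * (1 + 4) ^+ 2 :> R by ring.
  by apply: poisson_int_harnack => //; rewrite 1?cmodB; lra.
pose x : R := (2 - l) / l; pose X : R := (1 + cmod z) / (1 - cmod z).
have dz : 0 < 1 - cmod z by lra.
have xl : x = 2 / l - 1 by rewrite /x mulrBl divff // gt_eqF.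
have Xz : X = 2 / (1 - cmod z) - 1.
  by rewrite /X; field; rewrite gt_eqF.
have il : 1 <= l^-1 by rewrite invf_ge1.
have x1 : 1 <= x by rewrite xl; lra.
have xX : x <= X.
  by rewrite xl Xz lerD2r ler_pM2l // lef_pV2 ?posrE.
have m0 : 0 < (2 : R) ^+ m.+1 by rewrite exprn_gt0.
have Xn : X <= 2 ^+ m.+2 * x.
  apply: (@le_trans _ _ (2 ^+ m.+2 / l)).
    have : (1 - cmod z)^-1 <= 2 ^+ m.+1 / l.
      by rewrite -[leRHS]invf_div lef_pV2 ?posrE ?divr_gt0.
    by rewrite Xz => hi; rewrite (exprS _ m.+1) -[leRHS]mulrA; lra.
  by rewrite ler_pM2l ?exprn_gt0 // xl; lra.
have := poisson_int_growth sigma_fin k01 hk (a + l / 2 + d) x1 xX Xn.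
have -> : hrad x = 1 - l.
  rewrite /hrad xl subrK; by field; rewrite gt_eqF.
have -> : hrad X = cmod z.
  rewrite /hrad Xz subrK; by field; rewrite gt_eqF.
rewrite -/e -zE -/w -/L => -[G1 G2].
have /andP[L1 _] : 1 <= L < 2 by exact: growth_rate_bounds.
have Ln : 0 < L ^+ m.+2 by rewrite exprn_gt0 //; lra.
split.
  by apply: le_trans G1 _; rewrite mulrC ler_pM2r.
by apply: le_trans H2 _; rewrite -mulrA ler_pM2l.
Qed.

(** The integrals of u and 1/u are at most D l^2 U and D l^2 / U with U = u(z_I), so U cancels in
    the product; the area of the box is at least l^2 / 64. *)
Lemma contractive_B2 (k : R) : 0 <= k < 1 ->
  (forall z v, cmod z < 1 -> cmod v = 1 -> E (dpoisson z v) <= k * u z) ->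
  B2_weight u.
Proof.
move=> k01 hk; set L := growth_rate k.
have L12 : 1 <= L < 2 by exact: growth_rate_bounds.
have /andP[L1 L2] := L12.
have L0 : 0 < L by lra.
have A0 : 0 <= 50 * L ^+ 2 by apply: mulr_ge0 => //; exact: sqr_ge0.
pose D : R := cover_const R * (50 * L ^+ 2) / (1 - L / 2).
have D0 : 0 <= D.
  by rewrite /D divr_ge0 ?mulr_ge0 ?cover_const_ge0 ?exprn_ge0 ?(ltW L0) //; lra.
exists ((64 * D) ^+ 2) => a l l01; have /andP[l0 l1] := l01.
have [q hq /andP[q1 _]] := lambda2_box_fin a l01.
have q0 : 0 < q by apply: lt_le_trans q1; rewrite exprn_gt0 // divr_gt0.
have bounds := contractive_box_bounds k01 hk; rewrite /= -/L in bounds.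
have zI1 : cmod (z_arc a l) < 1 by rewrite cmod_z_arc //; lra.
have uI := u_gt0 zI1; set U := u (z_arc a l) in uI.
have box1 p : carleson_box a l p -> cmod (cplx p) < 1.
  by move=> /carleson_boxP[d [_ /andP[]]].
rewrite !(box_avgE _ q0 hq).
have I1 := @box_integral_le _ u (50 * L ^+ 2 * U) L a l l01 L12.
have I2 := @box_integral_le _ (fun z => (u z)^-1) (50 * L ^+ 2 / U) L a l l01 L12.
set J1 := (\int[_]_(_ in _) _)%E in I1 *; set J2 := (\int[_]_(_ in _) (_^-1)%:E)%E in I2 *.
have {}I1 : (J1 <= (D * l ^+ 2 * U)%:E)%E.
  rewrite (_ : D * l ^+ 2 * U = cover_const R * l ^+ 2 * (50 * L ^+ 2 * U) / (1 - L / 2));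
    last by rewrite /D; ring.
  apply: I1.
  - exact: mulr_ge0 A0 (ltW uI).
  - by move=> p /box1 p1; exact/ltW/u_gt0.
  - move=> m p pQ hm; have [h _] := bounds _ _ _ _ l01 pQ hm.
    by apply: le_trans h _; rewrite -/U -(addn2 m) exprD le_eqVlt; apply/orP; left;
      apply/eqP; ring.
have {}I2 : (J2 <= (D * l ^+ 2 / U)%:E)%E.
  rewrite (_ : D * l ^+ 2 / U = cover_const R * l ^+ 2 * (50 * L ^+ 2 / U) / (1 - L / 2));
    last by rewrite /D; ring.
  apply: I2.
  - exact: divr_ge0 A0 (ltW uI).
  - by move=> p /box1 p1; rewrite invr_ge0; exact/ltW/u_gt0.
  - move=> m p pQ hm; have [_ h] := bounds _ _ _ _ l01 pQ hm.
    have up := u_gt0 (box1 _ pQ).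
    rewrite -div1r ler_pdivrMr // -/U (_ : _ * u _ = 50 * L ^+ m.+2 * u (cplx p) / U);
      last by rewrite -(addn2 m) exprD; ring.
    by rewrite ler_pdivlMr // mul1r.
have J10 : (0 <= J1)%E by apply: integral_ge0 => p /box1 p1; rewrite lee_fin; exact/ltW/u_gt0.
have J20 : (0 <= J2)%E.
  by apply: integral_ge0 => p /box1 p1; rewrite lee_fin invr_ge0; exact/ltW/u_gt0.
have qi0 : 0 <= q^-1 by rewrite invr_ge0 ltW.
apply: (@le_trans _ _ ((q^-1 * (D * l ^+ 2 * U)) * (q^-1 * (D * l ^+ 2 / U)))%:E).
  rewrite EFinM; apply: lee_pmul.
  - by rewrite mule_ge0 // lee_fin.
  - by rewrite mule_ge0 // lee_fin.
  - by rewrite EFinM lee_wpmul2l // lee_fin.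
  - by rewrite EFinM lee_wpmul2l // lee_fin.
rewrite lee_fin [leLHS](_ : _ = (D * (l ^+ 2 / q)) ^+ 2); last first.
  by field; rewrite !gt_eqF.
have : l ^+ 2 / q <= 64.
  by rewrite ler_pdivrMr //; move: q1; rewrite expr_div_n; lra.
have : 0 <= l ^+ 2 / q by rewrite divr_ge0 ?exprn_ge0 // ltW.
move: (l ^+ 2 / q) => y y0 y64.
have h : D * y <= 64 * D by rewrite [D * y]mulrC ler_wpM2r.
by apply: lerXn2r; rewrite ?nnegrE //; apply: mulr_ge0.
Qed.

End ContractiveB2.

(** * The B2 condition implies the arc condition *)

Section FiniteSums.
Variable R : realType.

(* x / (1 + |x|) increases from -1 to 1, and by at least a quarter of
   1 / (1 + x^2) on [x, x + 1] *)
Lemma sum_inv_onesqr_le (M : nat) (v : R) :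
  \sum_(j < M) (1 + (j%:R - v) ^+ 2)^-1 <= 8.
Proof.
pose phi (x : R) := x / (1 + `|x|).
have pos (x : R) : 0 < 1 + `|x| by rewrite ltr_pwDl.
have phi1 x : `|phi x| <= 1.
  by rewrite normrM normfV (gtr0_norm (pos x)) ler_pdivrMr // mul1r lerDr.
have step x : (1 + x ^+ 2)^-1 <= 4 * (phi (x + 1) - phi x).
  have q0 : 0 < 1 + x ^+ 2 by rewrite ltr_pwDl // sqr_ge0.
  rewrite -div1r ler_pdivrMr //.
  have [x0|x0] := leP 0 x.
    rewrite /phi !ger0_norm //; last by lra.
    rewrite (_ : _ - _ = ((1 + x) * (2 + x))^-1); last first.
      by field; repeat (apply/andP; split); (rewrite gt_eqF; lra) || (rewrite lt_eqF; lra).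
    rewrite mulrAC ler_pdivlMr ?mul1r; last by rewrite mulr_gt0; lra.
    nra.
  have [x1|x1] := leP (x + 1) 0.
    rewrite /phi !ler0_norm //; last by lra.
    rewrite (_ : _ - _ = ((1 - x) * (- x))^-1); last first.
      by field; repeat (apply/andP; split); (rewrite gt_eqF; lra) || (rewrite lt_eqF; lra).
    rewrite mulrAC ler_pdivlMr ?mul1r; last by rewrite mulr_gt0; lra.
    nra.
  rewrite /phi (gtr0_norm x1) (ltr0_norm x0).
  have h1 : (x + 1) / 2 <= (x + 1) / (1 + (x + 1)).
    by rewrite ler_pM2l // lef_pV2 ?posrE; lra.
  have h2 : - x / 2 <= - (x / (1 - x)).
    by rewrite -mulNr ler_pM2l ?lef_pV2 ?posrE; lra.
  have h3 : 1 / 2 <= (x + 1) / (1 + (x + 1)) - x / (1 + - x) by lra.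
  have := sqr_ge0 x; move: h3; move: (_ - _) => w; nra.
have : \sum_(j < M) (1 + (j%:R - v) ^+ 2)^-1 <= 4 * (phi (M%:R - v) - phi (- v)).
  elim: M => [|M IH]; first by rewrite big_ord0 sub0r subrr mulr0.
  rewrite big_ord_recr /=.
  have := step (M%:R - v); rewrite (_ : M%:R - v + 1 = M.+1%:R - v); last first.
    by rewrite -(natr1 M); ring.
  lra.
have := phi1 (M%:R - v); have := phi1 (- v); rewrite !ler_norml => /andP[? ?] /andP[? ?].
lra.
Qed.

(** The Cauchy-Schwarz bound, obtained by summing the tangent line of 1/x at the mean value B /
    M. *)
Lemma sum_inv_ge (M : nat) (x : nat -> R) (B : R) : 0 < B ->
  (forall j, 0 < x j) -> \sum_(0 <= j < M) x j <= B ->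
  M%:R ^+ 2 / B <= \sum_(0 <= j < M) (x j)^-1.
Proof.
move=> B0 x0 xB; pose c := M%:R / B.
have tangent j : 2 * c - c ^+ 2 * x j <= (x j)^-1.
  rewrite -[leRHS]div1r ler_pdivlMr // -subr_ge0.
  by rewrite (_ : _ - _ = (1 - c * x j) ^+ 2) ?sqr_ge0 //; ring.
apply: (@le_trans _ _ (\sum_(0 <= j < M) (2 * c - c ^+ 2 * x j))); last first.
  by apply: ler_sum => j _; exact: tangent.
rewrite sumrB sumr_const_nat subn0 -mulr_sumr -[2 * c *+ M]mulr_natr.
have h := ler_wpM2l (sqr_ge0 c) xB.
have -> : M%:R ^+ 2 / B = 2 * c * M%:R - c ^+ 2 * B.
  by rewrite /c; field; rewrite gt_eqF.
lra.
Qed.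

(** Applied at a point to weighted indicators of pairwise disjoint sets. *)
Lemma sum_nat_at_most_one (N : nat) (F : nat -> R) (B : R) : 0 <= B ->
  (forall n, (n < N)%N -> F n <= B) ->
  (forall n n', (n < N)%N -> (n' < N)%N -> F n != 0 -> F n' != 0 -> n = n') ->
  \sum_(0 <= n < N) F n <= B.
Proof.
move=> B0; elim: N => [|N IH] FB Fu; first by rewrite big_nil.
rewrite big_nat_recr //=; have [FN|FN] := eqVneq (F N) 0.
  rewrite FN addr0; apply: IH => [n nN|n n' nN n'N]; first by apply: FB; exact: ltnW.
  by apply: Fu; exact: ltnW.
rewrite big_nat big1 ?add0r; first exact: FB.
move=> n /= nN; apply/eqP; apply: contraT => Fn.
have e := Fu n N (ltnW nN) (ltnSn N) Fn FN.
by rewrite e ltnn in nN.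
Qed.

End FiniteSums.

Section B2ArcLower.
Variables (R : realType) (sigma : {measure set R -> \bar R}).
Hypothesis sigma_fin : (sigma setT < +oo)%E.
Implicit Types (z w v : R[i]) (a l r s t d y : R).

Local Notation E g := (\int[sigma]_(t in `[0%R, 1%R[) g t).
Local Notation u := (poisson_int sigma).
Local Notation cplx p := (p.1 +i* p.2)%C.
Local Notation lambda2 := (@lebesgue_measure R \x @lebesgue_measure R)%E.
Local Notation K := (off_arc_const R).

Hypothesis u_gt0 : forall z, cmod z < 1 -> 0 < u z.

(** Points of height y above the middle half of the arc, in angular steps of y, starting at offset
    -l/4. *)
Definition node a l y (j : nat) : R[i] :=
  (1 - y)%:C%C * circ (a + l / 2 + (j%:R * y - l / 4)).

Lemma cmod_node a l y j : 0 < y <= 1 -> cmod (node a l y j) = 1 - y.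
Proof. by move=> /andP[y0 y1]; rewrite cmod_radial // subr_ge0. Qed.

(** For e on the arc the kernels are dominated by (34 / y) / (1 + (j - v)^2), whose sum over j is
    O(1/y). For e off the arc each of the M terms is at most K (y / l) times the kernel of z_I, and
    M y <= l/2. *)
Lemma sum_poisson_node a l y M t : 0 < l <= 1 -> 0 < y <= 1 -> M%:R * y <= l / 2 ->
  0 <= t < 1 ->
  \sum_(j < M) poisson (node a l y j) t <=
    34 * 8 / y * \1_(circ_arc a l) t + K * poisson (z_arc a l) t.
Proof.
move=> l01 y01 My t01; have [/andP[l0 l1] /andP[y0 y1]] := (l01, y01).
have zI1 : cmod (z_arc a l) < 1 by rewrite cmod_z_arc //; lra.
have PI0 := poisson_gt0 t zI1.
have K1 := off_arc_const_ge1 R.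
have jM (j : 'I_M) : `|j%:R * y - l / 4| <= l / 4.
  have : j%:R * y <= M%:R * y by rewrite ler_pM2r // ler_nat ltnW.
  have : 0 <= j%:R * y by rewrite mulr_ge0 // ltW.
  by move=> ? ?; rewrite ler_norml; apply/andP; split; lra.
rewrite indicE; have [tI|tI] := boolP (t \in _); last first.
  rewrite mulr0 add0r.
  have off j : poisson (node a l y (nat_of_ord (j : 'I_M))) t <= K * (y / l) * poisson
    (z_arc a l) t.
    have tI' : ~ circ_arc a l t by move=> h; move/negP: tI; apply; rewrite inE.
    have := @poisson_off_arc R a l t (j%:R * y - l / 4) (1 - y) l01 t01 tI' (jM j).
    rewrite subKr => /(_ _)/le_trans; apply; last by [].
    by apply/andP; split; lra.
  apply: le_trans (ler_sum _ (fun j _ => off j)) _.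
  rewrite sumr_const card_ord -[_ *+ M]mulr_natl.
  rewrite [leLHS](_ : _ = K * poisson (z_arc a l) t * (M%:R * y / l)); last by ring.
  apply: ler_piMr; first by apply: mulr_ge0; [lra|exact: ltW].
  by rewrite ler_pdivrMr // mul1r; lra.
rewrite mulr1 inE in tI *; have [tau [tl te]] := circ_arc_in tI.
apply: (@le_trans _ _ (34 / y * \sum_(j < M) (1 + (j%:R - (tau + l / 4) / y) ^+ 2)^-1));
  last first.
  apply: (@le_trans _ _ (34 * 8 / y)).
    by rewrite [leRHS]mulrAC ler_pM2l ?divr_gt0 //; exact: sum_inv_onesqr_le.
  by rewrite lerDl; apply: mulr_ge0; [lra|exact: ltW].
rewrite mulr_sumr; apply: ler_sum => j _.
set z := node a l y j.
have z1 : cmod z < 1 by rewrite cmod_node //; lra.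
set x := j%:R - _.
have q0 : 0 < 1 + x ^+ 2 by rewrite ltr_pwDl // sqr_ge0.
have xy : x * y = j%:R * y - l / 4 - tau.
  by rewrite /x; field; rewrite gt_eqF.
have h1 : `|x * y| <= 4 * cmod (circ t - z).
  have := @cmod_circB_proj R (1 - y) (a + l / 2 + (j%:R * y - l / 4)) t.
  have := @chord_ge34 R (a + l / 2 + tau) (a + l / 2 + (j%:R * y - l / 4)).
  rewrite -te -/z (_ : `|_ + tau - _| = `|x * y|); last first.
    by rewrite xy distrC; congr `|_|; ring.
  have := jM j; move: tl; rewrite xy !ler_norml => /andP[? ?] /andP[? ?].
  move=> g1 g2.
  have e1 : - (3 / 4) <= j%:R * y - l / 4 - tau <= 3 / 4 by apply/andP; split; lra.
  have e2 : 0 <= 1 - y < 1 by apply/andP; split; lra.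
  have := g1 e1; have := g2 e2 => f1 f2.
  rewrite -ler_norml; lra.
have h2 := cmod_circB_ge z t; rewrite cmod_node // subKr in h2.
have /andP[_ h3] := onemsqr_cmod_bounds z1.
rewrite cmod_node // subKr in h3.
have c0 := cmod_circB_gt0 t z1.
rewrite /poisson ler_pdivrMr ?exprn_gt0 // cmod_node //.
(* The bounds |x y| <= 4 c and y <= c give y^2 (1 + x^2) <= 17 c^2; the factor 2 in 1 - |z|^2 <= 2 y
   makes 34. *)
set c := cmod (circ t - z) in h1 h2 c0 *.
have g1 : (x * y) ^+ 2 <= 16 * c ^+ 2.
  rewrite -[leLHS]real_normK ?num_real // (_ : 16 * c ^+ 2 = (4 * c) ^+ 2); last by ring.
  by apply: lerXn2r; rewrite ?nnegrE ?normr_ge0 // mulr_ge0 // ltW.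
have g2 : y ^+ 2 <= c ^+ 2 by apply: lerXn2r; rewrite ?nnegrE // ltW.
apply: le_trans h3 _.
rewrite [leRHS](_ : _ = 2 * (17 * c ^+ 2 / (y * (1 + x ^+ 2)))); last first.
  by field; rewrite !gt_eqF.
rewrite ler_pM2l // ler_pdivlMr ?mulr_gt0 //.
by move: g1; rewrite exprMn; lra.
Qed.

Lemma sum_poisson_int_node a l y M : 0 < l <= 1 -> 0 < y <= 1 -> M%:R * y <= l / 2 ->
  \sum_(0 <= j < M) u (node a l y j) <=
    34 * 8 / y * fine (sigma (circ_arc a l)) + K * u (z_arc a l).
Proof.
move=> l01 y01 My; have /andP[l0 l1] := l01; have /andP[y0 y1] := y01.
have bn j : bounded_measurable (poisson (node a l y j)).
  by apply: bounded_measurable_poisson; rewrite cmod_node //; lra.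
rewrite big_mkord -(bounded_Rintegral_sum sigma_fin M bn).
apply: poisson_int_indic_comp => //.
- exact: measurable_circ_arc.
- exact: circ_arc_sub.
- exact: (@bounded_measurable_sum R M (fun j => poisson (node a l y j)) bn).
- by rewrite cmod_z_arc //; lra.
- by move=> t t01; exact: sum_poisson_node.
Qed.

(** With this exponent [2 * 4 ^ n] nodes in steps of the level fill exactly the length l/2. *)
Definition level l (n : nat) : R := l / 4 ^+ n.+1.

Lemma level_bounds l n : 0 < l <= 1 -> 0 < level l n <= l / 4.
Proof.
move=> /andP[l0 l1]; rewrite divr_gt0 ?exprn_gt0 //= ler_pM2l //.
rewrite lef_pV2 ?posrE ?exprn_gt0 // exprS ler_peMr // exprn_ege1 // ler1n //.
Qed.

Definition node_square a l n j : set (R * R) :=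
  square (node a l (level l n) j) (level l n / 8).

Section NodeSquare.
Variables (a l : R).
Hypothesis l01 : 0 < l <= 1.

Lemma node_offset n j : (j < 2 * 4 ^ n)%N ->
  `|j%:R * level l n - l / 4| <= l / 4.
Proof.
move=> jn; have /andP[y0 _] := level_bounds n l01; have /andP[l0 _] := l01.
have : j%:R * level l n <= (2 * 4 ^ n)%:R * level l n by rewrite ler_pM2r // ler_nat ltnW.
have -> : (2 * 4 ^ n)%:R * level l n = l / 2.
  by rewrite /level natrM natrX exprS; field; rewrite expf_neq0.
have : 0 <= j%:R * level l n by rewrite mulr_ge0 // ltW.
by move=> ? ?; rewrite ler_norml; apply/andP; split; lra.
Qed.

Lemma node_squareP n j p : (j < 2 * 4 ^ n)%N -> node_square a l n j p ->
  [/\ carleson_box a l p, cmod (cplx p - node a l (level l n) j) <= level l n / 4 &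
    3 / 4 * level l n <= 1 - cmod (cplx p) <= 5 / 4 * level l n].
Proof.
move=> jn; have /andP[y0 y1] := level_bounds n l01; have /andP[l0 l1] := l01.
have := node_offset jn => hj.
apply: inscribed_square; first by apply/andP; split; lra.
- lra.
- lra.
Qed.

(** Heights in a square lie between 3/4 and 5/4 of its level, and the next level is four times
    smaller. *)
Lemma node_square_level n n' j j' p : (j < 2 * 4 ^ n)%N -> (j' < 2 * 4 ^ n')%N ->
  node_square a l n j p -> node_square a l n' j' p -> n = n'.
Proof.
wlog nn' : n n' j j' / (n <= n')%N.
  move=> H jn jn' hn hn'; have [nn'|n'n] := leqP n n'; first exact: (H n n' j j').
  by apply/esym/(H n' n j' j) => //; exact: ltnW.
move=> jn jn' /(node_squareP jn)[_ _ /andP[h1 _]] /(node_squareP jn')[_ _ /andP[_ h2]].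
apply/eqP; rewrite eqn_leq nn' /= leqNgt; apply/negP => lt.
have /andP[y0 _] := level_bounds n l01; have /andP[l0 _] := l01.
have : level l n' <= level l n / 4.
  rewrite /level -mulrA ler_pM2l // -invfM lef_pV2 ?posrE ?mulr_gt0 ?exprn_gt0 //.
  by rewrite -exprSr ler_eXn2l // ltr1n.
lra.
Qed.

(** Distinct nodes of a level y are at least (1 - y) 2 y >= 3/2 y apart, while a common point would
    put them within y/2. *)
Lemma node_square_inj n j j' p : (j < 2 * 4 ^ n)%N -> (j' < 2 * 4 ^ n)%N ->
  node_square a l n j p -> node_square a l n j' p -> j = j'.
Proof.
move=> jn jn' /(node_squareP jn)[_ h1 _] /(node_squareP jn')[_ h2 _].
have /andP[y0 y1] := level_bounds n l01; have /andP[l0 l1] := l01.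
have o1 := node_offset jn; have o2 := node_offset jn'.
set y := level l n in y0 y1 h1 h2 o1 o2 *.
have h3 := cmodBD (node a l y j) (node a l y j') (cplx p).
rewrite (cmodB _ (cplx p)) in h3.
apply/eqP; apply: contraT => jj'.
have dist : y <= `|j%:R * y - j'%:R * y|.
  rewrite -mulrBl normrM (gtr0_norm y0) ler_peMl ?(ltW y0) //.
  rewrite -[j%:R]/((j : int)%:~R) -[j'%:R]/((j' : int)%:~R) -intrB -intr_norm.
  by rewrite ler1z -gtz0_ge1 normr_gt0 subr_eq0 eqz_nat.
have dj : `|j%:R * y - j'%:R * y| <= 1 / 2.
  move: o1 o2; rewrite !ler_norml => /andP[? ?] /andP[? ?]; apply/andP; split; lra.
have := @chord_ge R (a + l / 2 + (j%:R * y - l / 4)) (a + l / 2 + (j'%:R * y - l / 4)).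
rewrite (_ : a + l / 2 + (j%:R * y - l / 4) - _ = j%:R * y - j'%:R * y); last by ring.
move=> /(_ dj) ch.
have : cmod (node a l y j - node a l y j') = (1 - y) *
   cmod (circ (a + l / 2 + (j%:R * y - l / 4)) - circ (a + l / 2 + (j'%:R * y - l / 4))).
  by rewrite /node -mulrBr cmodM cmodR ger0_norm //; lra.
move: ch; move: (cmod (circ _ - circ _)) => q ch e.
have : 3 / 4 * q <= (1 - y) * q by rewrite ler_wpM2r //; lra.
lra.
Qed.

Lemma poisson_int_node_square n j p : (j < 2 * 4 ^ n)%N -> node_square a l n j p ->
  u (cplx p) <= 16 * u (node a l (level l n) j).
Proof.
move=> jn hp; have [_ h1 /andP[h2 h3]] := node_squareP jn hp.
have /andP[y0 y1] := level_bounds n l01; have /andP[l0 l1] := l01.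
have y01 : 0 < level l n <= 1 by apply/andP; split; lra.
rewrite (_ : 16 = 2 * 2 * (1 + 1) ^+ 2); last by ring.
by apply: poisson_int_harnack; rewrite ?cmod_node //; lra.
Qed.

(** On the disjoint squares 1/u is at least 1/16 of the inverse of u at the node. By [sum_inv_ge]
    level n contributes at least (2 * 4^n)^2 / (T U) / 16 times the area (y/4)^2 of a square, with U
    = u(z_I). As 2 * 4^n * y = l/2, this amount does not depend on n. *)
Lemma inv_poisson_int_box_ge (N : nat) (T : R) : 0 < T ->
  (forall n, (n < N)%N ->
     \sum_(0 <= j < 2 * 4 ^ n) u (node a l (level l n) j) <= T * u (z_arc a l)) ->
  ((N%:R * (l ^+ 2 / (T * u (z_arc a l)) / 4 / 16 / 16))%:E <=
    \int[lambda2]_(p in carleson_box a l) ((u (cplx p))^-1)%:E)%E.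
Proof.
move=> T0 hT; have /andP[l0 l1] := l01.
have zI1 : cmod (z_arc a l) < 1 by rewrite cmod_z_arc //; lra.
have U0 := u_gt0 zI1; set U := u (z_arc a l) in U0 hT *.
pose y n := level l n.
have y0 n : 0 < y n by have /andP[] := level_bounds n l01.
have y1 n : y n <= l / 4 by have /andP[] := level_bounds n l01.
pose S n j := node_square a l n j.
have mS n j : measurable (S n j) by exact: measurable_square.
pose b n j := (16 * u (node a l (y n) j))^-1.
have un n j : 0 < u (node a l (y n) j).
  apply: u_gt0; rewrite cmod_node; first by have := y0 n; lra.
  by rewrite y0 (le_trans (y1 n)) //; lra.
have b0 n j : 0 <= b n j by rewrite invr_ge0 mulr_ge0 // ltW.
pose F n (p : R * R) : \bar R := (\sum_(0 <= j < 2 * 4 ^ n) (b n j * \1_(S n j) p)%:E)%E.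
have ind0 n j p : (0 <= (b n j * \1_(S n j) p)%:E)%E by rewrite lee_fin mulr_ge0.
have F0 n p : (0 <= F n p)%E by apply: sume_ge0.
have mind n j : measurable_fun setT (fun p => (b n j * \1_(S n j) p)%:E).
  by apply/measurable_EFinP; apply: measurable_funM => //; exact: measurable_indic.
have mF n : measurable_fun setT (F n) by apply: emeasurable_sum => j; exact: mind.
have u1 p : carleson_box a l p -> 0 < u (cplx p).
  by move=> /carleson_boxP[d [_ /andP[_ ?] _ _]]; exact: u_gt0.
rewrite integral_mkcond.
apply: (@le_trans _ _ (\int[lambda2]_p (\sum_(0 <= n < N) F n p))%E); last first.
  apply: ge0_le_integral_any => p; first by apply: sume_ge0.
  rewrite patchE /F; under eq_bigr do rewrite sumEFin; rewrite sumEFin.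
  have Sx n j : b n j * \1_(S n j) p != 0 -> S n j p.
    rewrite indicE; case: (boolP (p \in S n j)) => [/set_mem//|_].
    by rewrite mulr0 eqxx.
  have Fx n : \sum_(0 <= j < 2 * 4 ^ n) b n j * \1_(S n j) p != 0 ->
      exists2 j, (j < 2 * 4 ^ n)%N & S n j p.
    move=> hn; apply: contrapT => hS; move/eqP: hn; apply.
    rewrite big_nat big1 // => j /= jn; apply/eqP; apply: contraT => /Sx h.
    by exfalso; apply: hS; exists j.
  have bd : (if p \in carleson_box a l then ((u (cplx p))^-1)%:E else 0%E) =
      (if p \in carleson_box a l then (u (cplx p))^-1 else 0)%:E by case: ifP.
  rewrite /point /= in bd *; rewrite bd lee_fin {bd}.
  set B := if _ then _ else _.
  have B0 : 0 <= B.
    by rewrite /B; case: ifPn => // /set_mem /u1; rewrite invr_ge0; exact: ltW.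
  apply: sum_nat_at_most_one => // [n _|n n' _ _ /Fx[j jn hj] /Fx[j' jn' hj']]; last first.
    exact: (node_square_level jn jn' hj hj').
  apply: (@le_trans _ _ (\sum_(0 <= j < 2 * 4 ^ n) b n j * \1_(S n j) p)) => //.
  apply: sum_nat_at_most_one => // [j jn|j j' jn jn' /Sx hj /Sx hj']; last first.
    exact: (node_square_inj jn jn' hj hj').
  rewrite indicE; case: (boolP (p \in S n j)) => [/set_mem hj|_]; last by rewrite mulr0.
  have [pQ _ _] := node_squareP jn hj.
  rewrite mulr1 /B (mem_set pQ) /b lef_pV2 ?posrE.
  - exact: poisson_int_node_square.
  - by apply: mulr_gt0; [rewrite ltr0n|exact: un].
  - exact: u1.
rewrite (@ge0_integral_sum _ _ _ lambda2 setT measurableT _ _ mF (fun n p _ => F0 n p)).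
have intF n : (\int[lambda2]_p F n p = (\sum_(0 <= j < 2 * 4 ^ n) b n j * (y n / 4) ^+
  2)%:E)%E.
  rewrite /F (@ge0_integral_sum _ _ _ lambda2 setT measurableT _ _ (mind n) (fun j p _
    => ind0 n j p)).
  rewrite -sumEFin; apply: eq_bigr => j _.
  apply: (etrans (@integral_cst_indic _ _ _ lambda2 (S n j) _ (mS n j) (b0 n j))).
  rewrite [RHS]EFinM; congr (_ * _)%E.
  rewrite (_ : y n / 4 = 2 * (y n / 8)); last by lra.
  by apply: lambda2_square; rewrite divr_gt0.
apply: (@le_trans _ _ (\sum_(0 <= n < N) (l ^+ 2 / (T * U) / 4 / 16 / 16)%:E)%E).
  by rewrite sumEFin sumr_const_nat subn0 mulr_natl.
rewrite big_nat [leRHS]big_nat; apply: lee_sum => n /= nN.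
rewrite intF lee_fin -mulr_suml.
have -> : \sum_(0 <= j < 2 * 4 ^ n) b n j = (\sum_(0 <= j < 2 * 4 ^ n) (u (node a l (y n)
  j))^-1) / 16.
  by rewrite mulr_suml; apply: eq_bigr => j _; rewrite /b invfM mulrC.
have := @sum_inv_ge R (2 * 4 ^ n) (fun j => u (node a l (y n) j)) (T * U).
move=> /(_ (mulr_gt0 T0 U0) (un n) (hT n nN)).
set W := \sum_(0 <= j < _) _ => hW.
have -> : l ^+ 2 / (T * U) / 4 / 16 / 16 = (2 * 4 ^ n)%:R ^+ 2 / (T * U) / 16 * (y n / 4) ^+ 2.
  rewrite /y /level natrM natrX (exprS 4 n); field.
  by rewrite !gt_eqF ?expf_neq0.
by rewrite ler_wpM2r ?sqr_ge0 // ler_pM2r // invr_gt0.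
Qed.

(** One inscribed square around height l/2 suffices; there Harnack compares u with u(z_I), with
    constant 24 = 2 * 3 * (1 + 1)^2. *)
Lemma poisson_int_box_ge :
  ((u (z_arc a l) / 24 * (l / 8) ^+ 2)%:E <=
    \int[lambda2]_(p in carleson_box a l) (u (cplx p))%:E)%E.
Proof.
have /andP[l0 l1] := l01.
have zI1 : cmod (z_arc a l) < 1 by rewrite cmod_z_arc //; lra.
have U0 := u_gt0 zI1.
set z0 := (1 - l / 2)%:C%C * circ (a + l / 2 + 0).
have u1 p : carleson_box a l p -> 0 < u (cplx p).
  by move=> /carleson_boxP[d [_ /andP[_ ?] _ _]]; exact: u_gt0.
have mS := measurable_square z0 (l / 2 / 8).
have c0 : 0 <= u (z_arc a l) / 24 by rewrite divr_ge0 // ltW.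
rewrite integral_mkcond.
apply: (@le_trans _ _ (\int[lambda2]_p (u (z_arc a l) / 24 * \1_(square z0 (l / 2 / 8))
  p)%:E)%E).
  rewrite (@integral_cst_indic _ _ _ lambda2 _ _ mS c0) EFinM lee_wpmul2l ?lee_fin //.
  rewrite (_ : l / 8 = 2 * (l / 2 / 8)); last by lra.
  by rewrite -(lambda2_square z0) //; lra.
apply: ge0_le_integral_any => p; first by rewrite lee_fin mulr_ge0.
rewrite patchE indicE; case: (boolP (p \in square _ _)) => [/set_mem hp|_]; last first.
  by rewrite mulr0; case: ifPn => // /set_mem /u1 /ltW; rewrite lee_fin.
have A1 : 0 < l / 2 <= 1 / 2 by apply/andP; split; lra.
have A2 : 5 / 4 * (l / 2) <= l by lra.
have A3 : `|0 : R| + l / 2 / 2 <= l / 2 by rewrite normr0; lra.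
have [pQ h1 /andP[h2 h3]] := inscribed_square A1 A2 A3 hp.
rewrite -/z0 in h1.
rewrite (mem_set pQ) mulr1 lee_fin ler_pdivrMr // mulrC.
have p1 : cmod (cplx p) < 1 by lra.
rewrite (_ : 24 = 2 * 3 * (1 + 1) ^+ 2); last by ring.
apply: poisson_int_harnack => //; rewrite ?cmod_z_arc //; try lra.
have h4 := cmodBD (z_arc a l) (cplx p) z0; rewrite (cmodB z0) in h4.
have h5 : cmod (z_arc a l - z0) = l / 2.
  rewrite /z_arc /z0 addr0 -mulrBl cmodM cmod_circ mulr1 -rmorphB cmodR.
  by rewrite ler0_norm; lra.
lra.
Qed.

End NodeSquare.

Lemma B2_arc_lower : B2_weight u ->
  exists2 c : R, 0 < c & forall a l, 0 < l <= 1 ->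
    c * l * u (z_arc a l) <= fine (sigma (circ_arc a l)).
Proof.
move=> [C hC].
have K1 := off_arc_const_ge1 R.
have [T T0 TE] : exists2 T : R, 0 < T & T = 34 * 8 + K.
  by exists (34 * 8 + K) => //; apply: ltr_wpDl; rewrite ?mulr_ge0 // (lt_le_trans ltr01).
(* The lower bounds for the two integrals and the upper bound for the area make the product of
   averages at least N / D, so N > C D contradicts the B2 bound. *)
pose D : R := 24 * 64 * (T * 4 * 16 * 16) * (cover_const R * 2) ^+ 2.
have [N [hN N1]] : exists N : nat, C * D < N%:R /\ 0 < N%:R :> R.
  exists (Num.truncn `|C * D|).+1; split; last by rewrite ltr0n.
  exact: le_lt_trans (ler_norm _) (truncnS_gt _).
have N0 : 0 < (4 : R) ^+ N by rewrite exprn_gt0.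
exists (1 / 4 ^+ N); first by rewrite divr_gt0.
move=> a l l01; rewrite leNgt; apply/negP => small.
have /andP[l0 l1] := l01.
have zI1 : cmod (z_arc a l) < 1 by rewrite cmod_z_arc //; lra.
have U0 := u_gt0 zI1; set U := u (z_arc a l) in U0 small.
have S0 : 0 <= fine (sigma (circ_arc a l)) by rewrite fine_ge0.
have hT n : (n < N)%N ->
    \sum_(0 <= j < 2 * 4 ^ n) u (node a l (level l n) j) <= T * u (z_arc a l).
  move=> nN; have /andP[y0 y1] := level_bounds n l01.
  apply: le_trans (sum_poisson_int_node _ l01 _ _) _.
  - by apply/andP; split; lra.
  - rewrite /level natrM natrX exprS le_eqVlt; apply/orP; left; apply/eqP.
    by field; rewrite expf_neq0.
  rewrite -/U TE [(_ + K) * U]mulrDl lerD2r -[_ / _ * _]mulrA ler_pM2l ?mulr_gt0 //.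
  rewrite mulrC ler_pdivrMr //; apply/ltW; apply: lt_le_trans small _.
  (* Since n < N, the assumed smallness gives sigma(I) <= [level l n] u(z_I), so the arc term of
     [sum_poisson_int_node] is at most 34 * 8 u(z_I). *)
  have h4 : (4 ^+ N)^-1 <= (4 ^+ n.+1)^-1 :> R.
    by rewrite lef_pV2 ?posrE ?exprn_gt0 // ler_eXn2l // ltr1n.
  have := ler_wpM2l (mulr_ge0 (ltW U0) (ltW l0)) h4.
  by rewrite /level mulrA; congr (_ <= _); ring.
have I2 := inv_poisson_int_box_ge l01 T0 hT.
have I1 := poisson_int_box_ge a l01.
have [q hq /andP[q1 q2]] := lambda2_box_fin a l01.
have q0 : 0 < q by apply: lt_le_trans q1; rewrite exprn_gt0 // divr_gt0.
have := hC a l l01; rewrite !(box_avgE _ q0 hq) leNgt => /negP; apply.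
rewrite -/U in I1 I2.
set J1 := (\int[_]_(_ in _) _)%E in I1 *; set J2 := (\int[_]_(_ in _) (_^-1)%:E)%E in I2 *.
have qi0 : 0 <= q^-1 by rewrite invr_ge0 ltW.
have l20 : 0 < l ^+ 2 by rewrite exprn_gt0.
have a1 : 0 <= U / 24 * (l / 8) ^+ 2 by rewrite mulr_ge0 ?sqr_ge0 // divr_ge0 // ltW.
have a2 : 0 <= N%:R * (l ^+ 2 / (T * U) / 4 / 16 / 16).
  by rewrite mulr_ge0 // !divr_ge0 ?mulr_ge0 ?(ltW T0) ?(ltW U0) // ltW.
apply: (@lt_le_trans _ _ ((q^-1 * (U / 24 * (l / 8) ^+ 2)) *
   (q^-1 * (N%:R * (l ^+ 2 / (T * U) / 4 / 16 / 16))))%:E); last first.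
  rewrite EFinM; apply: lee_pmul.
  - by rewrite lee_fin mulr_ge0.
  - by rewrite lee_fin mulr_ge0.
  - by rewrite EFinM lee_wpmul2l // lee_fin.
  - by rewrite EFinM lee_wpmul2l // lee_fin.
rewrite lte_fin.
have -> : q^-1 * (U / 24 * (l / 8) ^+ 2) * (q^-1 * (N%:R * (l ^+ 2 / (T * U) / 4 / 16 / 16)))
  = N%:R * (l ^+ 2) ^+ 2 / (24 * 64 * (T * 4 * 16 * 16)) / q ^+ 2.
  by field; rewrite !gt_eqF.
have d0 : 0 < 24 * 64 * (T * 4 * 16 * 16) by rewrite !mulr_gt0.
rewrite ltr_pdivlMr ?exprn_gt0 // ltr_pdivlMr //.
have d00 := ltW d0; have q20 : 0 <= q ^+ 2 by exact: sqr_ge0.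
have [C0|C0] := leP C 0.
  apply: (@le_lt_trans _ _ 0); last by apply: mulr_gt0 => //; rewrite exprn_gt0.
  by rewrite -mulrA; apply: mulr_le0_ge0 => //; exact: mulr_ge0.
have q2' : q ^+ 2 <= (cover_const R * l ^+ 2 * 2) ^+ 2.
  by apply: lerXn2r => //; rewrite nnegrE ?(le_trans (ltW q0)) // ltW.
apply: (@le_lt_trans _ _ (C * D * (l ^+ 2) ^+ 2)); last first.
  by rewrite ltr_pM2r // exprn_gt0.
rewrite (_ : C * D * _ = C * (cover_const R * l ^+ 2 * 2) ^+ 2 * (24 * 64 * (T * 4 * 16 *
  16))); last first.
  rewrite /D; move: (24 * 64 * _) (cover_const R) => e f; ring.
by rewrite ler_wpM2r // ler_pM2l.
Qed.

End B2ArcLower.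

(** * The equivalence of the three conditions *)

Lemma contractive_dpoissonP (R : realType) (f : R[i] -> R[i]) (alpha : R[i])
    (sigma : {measure set R -> \bar R}) :
  analytic_self_map f -> cmod alpha = 1 -> clark_measure f alpha sigma ->
  contractive f <-> exists2 k : R, 0 <= k < 1 & forall z v, cmod z < 1 -> cmod v = 1 ->
    \int[sigma]_(t in `[0%R, 1%R[) dpoisson z v t <= k * poisson_int sigma z.
Proof.
move=> fD alpha1 fsigma; split=> [[k [k1 hk]]|[k /andP[k0 k1] hk]].
  (* The growth estimates take a rate k >= 0. *)
  exists (Num.max k 0); first by rewrite le_max lexx orbT gt_max k1 ltr01.
  move=> z v z1 v1; apply: le_trans (E_dpoisson_le fD alpha1 fsigma z1 v1) _.
  rewrite ler_wpM2r ?(ltW (poisson_int_gt0 fD alpha1 fsigma z1)) //.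
  by rewrite le_max hk.
exists k; split=> // z z1; have [v [v1 hv]] := exists_E_dpoisson fD alpha1 fsigma z1.
by rewrite -(ler_pM2r (poisson_int_gt0 fD alpha1 fsigma z1)) -hv; exact: hk.
Qed.

Lemma arc_lower_boundE (R : realType) (sigma : {measure set R -> \bar R}) (a l c v : R) :
  (sigma setT < +oo)%E -> 0 < l ->
  ((c * v)%:E <= sigma (circ_arc a l) * (l^-1)%:E)%E =
  (c * l * v <= fine (sigma (circ_arc a l))).
Proof.
move=> sfin l0.
have /fineK <- : sigma (circ_arc a l) \is a fin_num.
  by rewrite ge0_fin_numE // (finite_measureS sfin) //; exact: measurable_circ_arc.
by rewrite -EFinM lee_fin ler_pdivlMr // mulrAC.
Qed.

Theorem theorem1 (R : realType) (f : R[i] -> R[i]) (alpha : R[i])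
  (sigma : {measure set R -> \bar R}) :
  analytic_self_map f -> cmod alpha = 1 -> clark_measure f alpha sigma ->
  [<-> contractive f;
       exists c : R, 0 < c /\ forall a l : R, 0 < l <= 1 ->
         ((sigma (circ_arc a l)) * (l^-1)%:E >= (c * poisson_int sigma (z_arc a l))%:E)%E;
       B2_weight (poisson_int sigma)].
Proof.
move=> fD alpha1 fsigma; have sfin := clark_finite fsigma.
have u_gt0 := poisson_int_gt0 fD alpha1 fsigma.
have contP := contractive_dpoissonP fD alpha1 fsigma.
(* The implication from (b) to (a) serves twice: (b) reaches (c) through (a), and (c) reaches (a)
   through (b). *)
have contractive_arc (c : R) : 0 < c -> (forall a l : R, 0 < l <= 1 ->
    c * l * poisson_int sigma (z_arc a l) <= fine (sigma (circ_arc a l))) -> contractive f.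
  move=> c0 hc; apply/contP; have [kappa kappa0 hk] := arc_lower_contractive sfin c0 hc.
  exists (Num.max (1 - kappa) 0); first by rewrite le_max lexx orbT gt_max ltr01 andbT; lra.
  move=> z v z1 v1; apply: le_trans (hk z v z1 v1) _.
  by rewrite ler_wpM2r ?(ltW (u_gt0 z z1)) // le_max lexx.
tfae.
- move/contP=> [k k01 hk]; have [c c0 hc] := contractive_arc_lower sfin k01 hk.
  exists c; split=> // a l l01; have /andP[l0 _] := l01.
  by rewrite arc_lower_boundE //; exact: hc.
- move=> [c [c0 hc]]; have /contP[k k01 hk] : contractive f.
    apply: (contractive_arc c c0) => a l l01; have /andP[l0 _] := l01.
    by rewrite -arc_lower_boundE //; exact: hc.
  exact: (contractive_B2 sfin u_gt0 k01 hk).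
- move/(B2_arc_lower sfin u_gt0) => [c c0 hc]; exact: contractive_arc hc.
Qed.
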